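(* Let $T$ be a subtree of $T_N^{*}$ having the same ends as $T_N^{*}$. Then $T$ is a contraction of $T_N^{*}$: on every geodesic connecting a point of $T_N^{*}-T$ to $T$, the stabilizers of the vertices are ordered increasingly with respect to inclusion in the direction of $T$. In particular, the amalgams (tree products of groups) associated to $T$ and to $T_N^{*}$ are the same, namely both are equal to $N$.
   Context: Let $k$ be a field of characteristic $p>0$, complete with respect to a discrete non-archimedean valuation, with valuation ring $\mathcal{O}$ and residue field $\bar{k}$. A Mumford curve of genus $g\ge 2$ over $k$ is a complete irreducible curve $X$ whose analytification is isomorphic to $\Gamma\backslash(\mathbf{P}^1_k-\mathcal{L}_\Gamma)$, where $\Gamma\subset PGL(2,k)$ is a Schottky group, i.e. a free discontinuous group of rank $g$, with limit set $\mathcal{L}_\Gamma$. Let $N$ be the normalizer of $\Gamma$ in $PGL(2,k)$, so that $\mathrm{Aut}(X)\cong N/\Gamma$. Let $S=\mathrm{Aut}(X)\backslash X$ and assume that $S$ has genus $0$. Assume that $k$ is large enough (after a finite extension) that all fixed points in $\mathbf{P}^1$ of non-trivial elements of finite order of $N$ are $k$-rational and that $N$ acts without inversions on the tree below. $\mathcal{T}$ denotes the Bruhat-Tits tree of $PGL(2,k)$: its vertices are the similarity classes of rank two $\mathcal{O}$-lattices in $k^2$, two vertices being joined by an edge if the corresponding quotient module has length one. Ends (equivalence classes of half-lines differing by a finite segment) of $\mathcal{T}$ correspond to points of $\mathbf{P}^1(k)$. For $u\neq v\in \mathbf{P}^1(k)$, $]u,v[$ denotes the apartment joining $u$ and $v$.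 $\mathcal{T}_N^{*}$ is the minimal subtree of $\mathcal{T}$ containing all apartments $]u,v[$, where $u,v$ range over the set consisting of all limit points of $N$ and all fixed points in $\mathbf{P}^1(k)$ of non-trivial elements of finite order of $N$. Put $T_N^{*}=N\backslash\mathcal{T}_N^{*}$. Because $S$ has genus $0$, $T_N^{*}$ is a tree; it has finitely many ends, corresponding to the branch points of $X\to S$. It is viewed as a subtree of $\mathcal{T}_N^{*}$ by choosing a section of the quotient map, and is made into a tree of groups by attaching to each vertex and each edge the stabilizer in $N$ of its lift. These stabilizers are finite. A subtree of groups $T'$ of a tree of groups $T$ in $\mathcal{T}$ is a contraction of $T$ if every geodesic connecting a point of $T-T'$ to $T'$ is a path on which the stabilizers of vertices are ordered increasingly with respect to inclusion upon approaching $T'$. The amalgam (tree product) of a tree of groups is the amalgam of its vertex groups along its edge groups. *)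

(* Defs.v *)
From HB Require Import structures.
From mathcomp Require Import all_boot all_order all_algebra.
From mathcomp Require Import boolp classical_sets.

Set Implicit Arguments.
Unset Strict Implicit.
Unset Printing Implicit Defensive.

Import Order.TTheory GRing.Theory Num.Theory.
Local Open Scope classical_set_scope.
Local Open Scope quotient_scope.
Local Open Scope ring_scope.

(* Graphs in the sense of Serre: oriented edges with a reversal, so that loops
   and multiple edges are allowed (they may occur in quotients). *)
Record graph (V E : Type) := Graph {
  verts : set V;
  edges : set E;
  src : E -> V;
  tgt : E -> V;
  rev : E -> E }.

Section Graphs.
Variables V E : Type.
Implicit Types (G : graph V E) (x y : V) (p : seq E) (A : set V).

Definition induced G A : graph V E :=
  Graph (verts G `&` A)
        [set e | [/\ edges G e, A (src G e) & A (tgt G e)]]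
        (src G) (tgt G) (rev G).

Fixpoint walk G x p y : Prop :=
  if p is e :: p' then [/\ edges G e, src G e = x & walk G (tgt G e) p' y]
  else verts G x /\ x = y.

Definition reduced G p : Prop :=
  forall p1 e f p2, p = p1 ++ [:: e, f & p2] -> f <> rev G e.

Definition is_tree G : Prop :=
  [/\ verts G !=set0,
      forall x y, verts G x -> verts G y -> exists p, walk G x p y &
      forall x p, walk G x p x -> reduced G p -> p = [::]].

(* In a tree, geodesics are the walks without backtracking. *)
Definition halfline G (c : nat -> E) : Prop :=
  forall i, [/\ edges G (c i), tgt G (c i) = src G (c i.+1)
              & c i.+1 <> rev G (c i)].

Definition same_end (c d : nat -> E) : Prop :=
  exists m n, forall i, c (m + i)%N = d (n + i)%N.

(* For a subtree T of a tree G: the (always injective) map from the ends of T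
   to the ends of G is onto. *)
Definition same_ends G T : Prop :=
  forall c, halfline G c -> exists2 d, halfline T d & same_end c d.

Record tree_of_groups (gT : Type) := TreeOfGroups {
  shape :> graph V E;
  vgroup : V -> set gT;
  egroup : E -> set gT }.

Definition sub_tree_of_groups gT (X : tree_of_groups gT) A :=
  TreeOfGroups (induced X A) (vgroup X) (egroup X).

(* The restriction of X to A is a contraction of X: it is a subtree of groups,
   and along each geodesic of X ending at its first vertex in A, the vertex
   groups increase. *)
Definition contraction gT (X : tree_of_groups gT) A : Prop :=
  [/\ A `<=` verts X, is_tree (induced X A) &
      forall x y p, verts X x -> ~ A x -> A y ->
        walk X x p y -> reduced X p ->
        (forall p1 e p2, p = p1 ++ e :: p2 -> ~ A (src X e)) ->
        forall p1 e p2, p = p1 ++ e :: p2 ->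
          vgroup X (src X e) `<=` vgroup X (tgt X e)].

End Graphs.

Definition hom_on (gT H : groupType) (A : set gT) (f : gT -> H) : Prop :=
  forall x y, A x -> A y -> f (x * y)%g = (f x * f y)%g.

(* The vertex and edge groups of X are subgroups of an ambient group gT.  The
   subgroup N, with the inclusions of the vertex groups, is the amalgam of the
   vertex groups along the edge groups, i.e. the direct limit in the category
   of groups of the diagram formed by the inclusions of the edge groups into
   the groups of their endpoints. *)
Definition is_amalgam V E (gT : groupType) (X : tree_of_groups V E gT)
    (N : set gT) : Prop :=
  (forall x, verts X x -> vgroup X x `<=` N) /\
  forall (H : groupType) (f : V -> gT -> H),
    (forall x, verts X x -> hom_on (vgroup X x) (f x)) ->
    (forall e, edges X e -> forall n, egroup X e n ->
       f (src X e) n = f (tgt X e) n) ->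
    let extends (h : gT -> H) :=
      hom_on N h /\ forall x, verts X x -> forall n, vgroup X x n -> h n = f x n
    in exists2 h, extends h &
         forall h', extends h' -> forall n, N n -> h' n = h n.

Section Actions.
Variables (V E : Type) (gT : groupType).
Variables (actV : gT -> V -> V) (actE : gT -> E -> E).
Implicit Types (G : graph V E) (N : set gT).

Definition without_inversion G N : Prop :=
  forall n e, N n -> edges G e -> actE n e <> rev G e.

Definition quotient_graph G N : graph (set V) (set E) :=
  Graph [set [set actV n x | n in N] | x in verts G]
        [set [set actE n e | n in N] | e in edges G]
        (fun o => src G @` o) (fun o => tgt G @` o) (fun o => rev G @` o).

(* D is the image of a section of G -> N \ G: a subtree of G which the
   quotient map sends isomorphically onto N \ G. *)
Definition is_section G N (D : set V) : Prop :=
  [/\ D `<=` verts G,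
      is_tree (induced G D),
      forall o, verts (quotient_graph G N) o -> exists! x, D x /\ o x &
      forall o, edges (quotient_graph G N) o ->
        exists! e, edges (induced G D) e /\ o e].

Definition stabilizer_tree G N (D : set V) : tree_of_groups V E gT :=
  TreeOfGroups (induced G D)
    (fun x => [set n | N n /\ actV n x = x])
    (fun e => [set n | N n /\ actE n e = e]).

End Actions.

Section PGL.
Variable k : fieldType.

Definition GL2 := {M : 'M[k]_2 | M \in unitmx}.

Definition homothetic (A B : GL2) : bool :=
  `[< exists2 c : k, c != 0 & val A = c *: val B >].

Lemma homothetic_refl : reflexive homothetic.
Proof. by move=> A; apply/asboolP; exists 1; rewrite ?oner_neq0 ?scale1r. Qed.

Lemma homothetic_sym : symmetric homothetic.
Proof.
suff H A B : homothetic A B -> homothetic B A by move=> A B; apply/idP/idP => /H.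
move=> /asboolP[c c0 e]; apply/asboolP; exists c^-1; first by rewrite invr_eq0.
by rewrite e scalerA mulVf // scale1r.
Qed.

Lemma homothetic_trans : transitive homothetic.
Proof.
move=> B A C /asboolP[c c0 e] /asboolP[d d0 f]; apply/asboolP.
by exists (c * d); rewrite ?mulf_neq0 // e f scalerA.
Qed.

Canonical homothetic_equiv :=
  EquivRel homothetic homothetic_refl homothetic_sym homothetic_trans.

Definition PGL2 := {eq_quot homothetic}.
HB.instance Definition _ := Choice.on PGL2.

Definition GL2_mul (A B : GL2) : GL2 :=
  Sub (val A *m val B) (etrans (unitmx_mul _ _) (introT andP (conj (valP A) (valP B)))).
Definition GL2_one : GL2 := Sub 1%:M (unitmx1 k 2).
Definition GL2_inv (A : GL2) : GL2 :=
  Sub (invmx (val A)) (etrans (unitmx_inv _) (valP A)).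

Definition PGL2_mul (x y : PGL2) : PGL2 := \pi_PGL2 (GL2_mul (repr x) (repr y)).
Definition PGL2_one : PGL2 := \pi_PGL2 GL2_one.
Definition PGL2_inv (x : PGL2) : PGL2 := \pi_PGL2 (GL2_inv (repr x)).

Lemma PGL2_eqP (A B : GL2) :
  reflect (exists2 c : k, c != 0 & val A = c *: val B)
          (\pi_PGL2 A == \pi_PGL2 B).
Proof. by rewrite piE; apply: asboolP. Qed.

Lemma repr_piP (A : GL2) :
  exists2 c : k, c != 0 & val (repr (\pi_PGL2 A)) = c *: val A.
Proof. by apply/PGL2_eqP; rewrite reprK. Qed.

Lemma PGL2_eq (A B : GL2) (c : k) :
  c != 0 -> val A = c *: val B -> \pi_PGL2 A = \pi_PGL2 B.
Proof. by move=> c0 e; apply/eqP/PGL2_eqP; exists c. Qed.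

Lemma PGL2_mulE (A B : GL2) :
  PGL2_mul (\pi_PGL2 A) (\pi_PGL2 B) = \pi_PGL2 (GL2_mul A B).
Proof.
have [c c0 eA] := repr_piP A; have [d d0 eB] := repr_piP B.
apply: (@PGL2_eq _ _ (c * d)); first by rewrite mulf_neq0.
transitivity (val (repr (\pi_PGL2 A)) *m val (repr (\pi_PGL2 B))); first by [].
by rewrite eA eB -scalemxAl -scalemxAr scalerA.
Qed.

Lemma PGL2_invE (A : GL2) : PGL2_inv (\pi_PGL2 A) = \pi_PGL2 (GL2_inv A).
Proof.
have [c c0 eA] := repr_piP A.
apply: (@PGL2_eq _ _ c^-1); first by rewrite invr_eq0.
transitivity (invmx (val (repr (\pi_PGL2 A)))); first by [].
by rewrite eA invmxZ // unitmxZ ?unitfE // (valP A).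
Qed.

Fact PGL2_mulA : associative PGL2_mul.
Proof.
elim/quotW=> A; elim/quotW=> B; elim/quotW=> C.
rewrite (PGL2_mulE B C) (PGL2_mulE A B) (PGL2_mulE A) (PGL2_mulE _ C).
by congr (\pi_PGL2 _); apply/val_inj; exact: mulmxA.
Qed.

Fact PGL2_mul1 : left_id PGL2_one PGL2_mul.
Proof.
elim/quotW=> A; rewrite (PGL2_mulE GL2_one A).
by congr (\pi_PGL2 _); apply/val_inj; exact: mul1mx.
Qed.

Fact PGL2_mulr1 : right_id PGL2_one PGL2_mul.
Proof.
elim/quotW=> A; rewrite (PGL2_mulE A GL2_one).
by congr (\pi_PGL2 _); apply/val_inj; exact: mulmx1.
Qed.

Fact PGL2_mulV : left_inverse PGL2_one PGL2_inv PGL2_mul.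
Proof.
elim/quotW=> A; rewrite (PGL2_invE A) (PGL2_mulE (GL2_inv A) A).
by congr (\pi_PGL2 _); apply/val_inj; exact: (mulVmx (valP A)).
Qed.

Fact PGL2_mulrV : right_inverse PGL2_one PGL2_inv PGL2_mul.
Proof.
elim/quotW=> A; rewrite (PGL2_invE A) (PGL2_mulE A (GL2_inv A)).
by congr (\pi_PGL2 _); apply/val_inj; exact: (mulmxV (valP A)).
Qed.

HB.instance Definition _ := isGroup.Build PGL2
  PGL2_mulA PGL2_mul1 PGL2_mulr1 PGL2_mulV PGL2_mulrV.

Definition matrix_of (x : PGL2) : 'M[k]_2 := val (repr x).

End PGL.

Definition normalizer (gT : groupType) (A : set gT) : set gT :=
  [set n | [set (n * a * n^-1)%g | a in A] = A].

Definition finite_order (gT : groupType) (x : gT) : Prop :=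
  exists2 n, (0 < n)%N & (x ^+ n)%g = 1%g.

(* The words without a factor l l^-1 represent the elements of A, and only the
   empty one represents 1. *)
Definition free_of_rank (gT : groupType) (r : nat) (A : set gT) : Prop :=
  exists a : 'I_r -> gT,
    let eval (w : seq ('I_r * bool)) : gT :=
      foldr (fun l x => (if l.2 then a l.1 else (a l.1)^-1) * x)%g 1%g w in
    A = range eval /\
    forall w, (forall w1 i b w2, w <> w1 ++ [:: (i, b), (i, ~~ b) & w2]) ->
      eval w = 1%g -> w = [::].

(* The value of v at 0 is irrelevant: v is only a valuation on k - {0}. *)
Record discrete_valuation (k : fieldType) (v : k -> int) : Prop := {
  valuationM : forall x y, x != 0 -> y != 0 -> v (x * y) = v x + v y;
  valuationD : forall x y, x != 0 -> y != 0 -> x + y != 0 ->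
    Num.min (v x) (v y) <= v (x + y);
  valuation_uniformizer : exists2 x, x != 0 & v x = 1 }.

Section Valued.
Variables (k : fieldType) (v : k -> int).

Definition val_ge (n : int) (x : k) : bool := (x == 0) || (n <= v x).

Definition converges (x : nat -> k) (l : k) : Prop :=
  forall n : int, exists m, forall i, (m <= i)%N -> val_ge n (x i - l).

Definition cauchy_seq (x : nat -> k) : Prop :=
  forall n : int, exists m, forall i j, (m <= i)%N -> (m <= j)%N ->
    val_ge n (x i - x j).

Definition complete_for : Prop :=
  forall x, cauchy_seq x -> exists l, converges x l.

Definition integer_ring : set k := [set x | val_ge 0 x].

(* Points of P^1(k) are lines in k^2. *)
Definition line (u : 'cV[k]_2) : set 'cV[k]_2 := [set c *: u | c in setT].

Definition P1 : set (set 'cV[k]_2) := [set line u | u in [set u | u != 0]].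

(* Another matrix of x changes the result by a homothety, hence changes neither
   the image of a line nor the similarity class of the image of a lattice. *)
Definition act_set (x : PGL2 k) (L : set 'cV[k]_2) : set 'cV[k]_2 :=
  [set matrix_of x *m u | u in L].

(* Convergence in P^1(k), the quotient of k^2 - {0} by k^*. *)
Definition P1_converges (x : nat -> set 'cV[k]_2) (l : set 'cV[k]_2) : Prop :=
  exists (u : nat -> 'cV[k]_2) (w : 'cV[k]_2),
    [/\ forall i, u i != 0 /\ x i = line (u i),
        w != 0 /\ l = line w &
        forall j, converges (fun i => u i j 0) (w j 0)].

Definition P1_closure (S : set (set 'cV[k]_2)) : set (set 'cV[k]_2) :=
  [set l | exists2 x, forall i : nat, S (x i) & P1_converges x l].

(* P^1(k) is metrizable, so that compactness is sequential compactness. *)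
Definition P1_compact (S : set (set 'cV[k]_2)) : Prop :=
  forall x : nat -> set 'cV[k]_2, (forall i, S (x i)) ->
    exists (phi : nat -> nat) (l : set 'cV[k]_2),
      [/\ {homo phi : i j / (i < j)%N}, S l & P1_converges (x \o phi) l].

Definition limit_points (A : set (PGL2 k)) : set (set 'cV[k]_2) :=
  [set l | exists (b : set 'cV[k]_2) (a : nat -> PGL2 k),
     [/\ P1 b, injective a, forall i, A (a i) &
         P1_converges (fun i => act_set (a i) b) l]].

(* Gerritzen - van der Put, Schottky groups and Mumford curves, I.1 *)
Definition discontinuous (A : set (PGL2 k)) : Prop :=
  (exists2 l, P1 l & ~ limit_points A l) /\
  forall b, P1 b -> P1_compact (P1_closure [set act_set a b | a in A]).

Definition schottky (r : nat) (A : set (PGL2 k)) : Prop :=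
  free_of_rank r A /\ discontinuous A.

Definition torsion_fixed_points (A : set (PGL2 k)) : set (set 'cV[k]_2) :=
  [set l | P1 l /\
     exists x, [/\ A x, x <> 1%g, finite_order x & act_set x l = l]].

(* Every fixed point of x in P^1(K), for K an extension field of k, i.e. every
   line of K^2 spanned by an eigenvector u, is defined over k. *)
Definition torsion_fixed_points_rational (A : set (PGL2 k)) : Prop :=
  forall x, A x -> x <> 1%g -> finite_order x ->
  forall (K : fieldType) (iota : {rmorphism k -> K}) (u : 'cV[K]_2) (c : K),
    u != 0 -> map_mx iota (matrix_of x) *m u = c *: u ->
    exists (w : 'cV[k]_2) (d : K), u = d *: map_mx iota w.

Definition lattice_of (P : 'M[k]_2) : set 'cV[k]_2 :=
  [set P *m u | u in [set u : 'cV[k]_2 | forall i, integer_ring (u i 0)]].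

Definition is_lattice (L : set 'cV[k]_2) : Prop :=
  exists2 P, P \in unitmx & L = lattice_of P.

Definition is_submodule (M : set 'cV[k]_2) : Prop :=
  [/\ M 0, forall u w, M u -> M w -> M (u + w) &
      forall a u, integer_ring a -> M u -> M (a *: u)].

(* The quotient L / L' is a simple module. *)
Definition colength_one (L' L : set 'cV[k]_2) : Prop :=
  [/\ L' `<=` L, L' <> L &
      forall M, is_submodule M -> L' `<=` M -> M `<=` L -> M = L' \/ M = L].

Definition similarity_class (L : set 'cV[k]_2) : set (set 'cV[k]_2) :=
  [set [set c *: u | u in L] | c in [set c : k | c != 0]].

Definition vertex := set (set 'cV[k]_2).

Definition adjacent (x y : vertex) : Prop :=
  exists L L', [/\ x L, y L' & colength_one L' L].

Definition bt_tree : graph vertex (vertex * vertex) :=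
  let V := [set similarity_class L | L in is_lattice] in
  Graph V [set e | [/\ V e.1, V e.2 & adjacent e.1 e.2]]
        fst snd (fun e => (e.2, e.1)).

Definition act_vertex (x : PGL2 k) (y : vertex) : vertex :=
  [set act_set x L | L in y].

Definition act_edge (x : PGL2 k) (e : vertex * vertex) : vertex * vertex :=
  (act_vertex x e.1, act_vertex x e.2).

(* The apartment ]u,w[: the classes of the lattices generated by a vector of
   the line u and a vector of the line w. *)
Definition apartment (u w : set 'cV[k]_2) : set vertex :=
  [set x | exists P : 'M[k]_2, [/\ P \in unitmx, u = line (col 0 P),
     w = line (col 1 P) & x = similarity_class (lattice_of P)]].

(* The vertices of the smallest subtree of bt_tree containing ]u,w[ for all
   distinct u, w in the set of points S. *)
Definition spanned_subtree (S : set (set 'cV[k]_2)) : set vertex :=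
  [set x | forall W, W `<=` verts bt_tree -> is_tree (induced bt_tree W) ->
     (forall u w, S u -> S w -> u <> w -> apartment u w `<=` W) -> W x].

(* The genus of the quotient curve of a Mumford curve by N / Gamma is the first
   Betti number of the quotient graph of tree_star N by N; genus 0 means that
   this quotient graph is a tree. *)
Definition tree_star (N : set (PGL2 k)) : graph vertex (vertex * vertex) :=
  induced bt_tree (spanned_subtree (limit_points N `|` torsion_fixed_points N)).

End Valued.

(* Main.v *)
Require Import Defs.
From mathcomp Require Import all_boot all_order all_algebra all_field.
From mathcomp Require Import boolp classical_sets functions cardinality.
From mathcomp Require Import ring zify.

(** Write star for the subtree of the Bruhat-Tits tree spanned by the limit points
    and the fixed points of torsion elements, on which [N] acts, and [D] for the
    section.  The heart of the matter is that [D] has no end vertices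
    ([section_leafless]).  At an end vertex [y] of [D] the stabilizer of [y] would
    permute transitively the edges of star at [y], since all of them are translates
    of the only edge of [D] at [y].  There are at least two such edges, because a
    vertex with one neighbour could be removed from the spanned subtree
    ([star_valency]).  The stabilizer is finite, and each non-trivial element of it
    has a fixed point in the projective line, hence fixes the half-line from [y] to
    that point, which lies in star ([fixed_edge]).  So every element of a finite group
    acting transitively on at least two edges fixes one of them, which contradicts a
    theorem of Jordan ([transitive_fixed_points]).

    A subtree [T] of [D] with the same ends must then be all of [D]: a walk leaving
    [T] could be continued for ever, and would lead to an end outside [T]
    ([leafless_same_ends]).  Thus the contraction property holds because no
    vertex is outside [T], and the two amalgams coincide.

    That the amalgam is [N] is Serre's theorem on groups acting on a tree with a
    tree as fundamental domain ([section_amalgam]).  A word in the vertex groups whose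
    product is trivial gives a closed walk in star; this walk backtracks, and at the
    turning point the word is shortened inside an edge group ([trivial_product]).

    Two auxiliary facts rest on matrix computations.  The Bruhat-Tits graph is a tree:
    its vertices are the balls of [k], each edge joins a ball to the next larger one,
    and two balls have a common larger ball ([bt_acyclic], [bt_connected]).  The
    stabilizers in [N] of the vertices are finite ([finite_stabilizer]): an element of
    [N] is determined by the conjugates of two non commuting elements of [Gamma]; for
    elements fixing a given vertex these conjugates have bounded matrices, and
    discontinuity leaves finitely many such elements of [Gamma] ([finite_bounded]). *)

Set Implicit Arguments.
Unset Strict Implicit.
Unset Printing Implicit Defensive.

Import Order.TTheory GRing.Theory Num.Theory.
Local Open Scope classical_set_scope.
Local Open Scope ring_scope.

(* The reversal of edges, not the reversal of sequences. *)
Local Notation rev := Defs.rev.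

(** * Walks in graphs and trees *)

Section GraphTheory.
Variables V E : Type.
Implicit Types (G : graph V E) (x y z : V) (e f : E) (p q : seq E) (A W : set V).

(** The axioms of a graph, at the edges that belong to it: the source, target
    and reversal maps are unconstrained elsewhere. *)
Definition serre_graph G : Prop := forall e, edges G e ->
  [/\ verts G (src G e), edges G (rev G e), src G (rev G e) = tgt G e
    & rev G (rev G e) = e].

Definition acyclic G : Prop :=
  forall x p, walk G x p x -> reduced G p -> p = [::].

Definition connected G : Prop :=
  forall x y, verts G x -> verts G y -> exists p, walk G x p y.

Definition back G p : seq E := seq.rev (map (rev G) p).

Lemma serre_tgt G e : serre_graph G -> edges G e ->
  verts G (tgt G e) /\ tgt G (rev G e) = src G e.
Proof.
move=> sG Ge; have [_ Gr sr rr] := sG e Ge; have [vr _ sr' _] := sG _ Gr.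
by rewrite -sr' rr -sr.
Qed.

Lemma walk_src G x p y : serre_graph G -> walk G x p y -> verts G x.
Proof. by move=> sG; case: p => [[]|e p [Ge <- _]] //; have [] := sG e Ge. Qed.

Lemma walk_tgt G x p y : walk G x p y -> verts G y.
Proof. by elim: p x => [x [vx <-]//|e p IH x [_ _ /IH]]. Qed.

Lemma walk_edge G e : serre_graph G -> edges G e ->
  walk G (src G e) [:: e] (tgt G e).
Proof. by move=> sG Ge; have [vt _] := serre_tgt sG Ge. Qed.

Lemma walk_cat G x y z p q :
  walk G x p y -> walk G y q z -> walk G x (p ++ q) z.
Proof.
by elim: p x => [x [_ ->]//|e p IH x /= [Ge se wp] wq]; split=> //; apply: IH.
Qed.

Lemma walk_catP G x z p q : serre_graph G -> walk G x (p ++ q) z ->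
  exists2 y, walk G x p y & walk G y q z.
Proof.
move=> sG; elim: p x => [x wq|e p IH x /= [Ge se /IH[y wp wq]]].
  by exists x => //=; split=> //; exact: walk_src wq.
by exists y.
Qed.

Lemma back_cons G e p : back G (e :: p) = back G p ++ [:: rev G e].
Proof. by rewrite /back /= rev_cons cats1. Qed.

Lemma walk_back G x p y : serre_graph G -> walk G x p y -> walk G y (back G p) x.
Proof.
move=> sG; elim: p x => [x [vx <-]//|e p IH x [Ge <- /IH wp]].
have [_ Gr sr _] := sG e Ge; have [_ tr] := serre_tgt sG Ge.
rewrite back_cons; apply: walk_cat wp _.
by rewrite -sr -tr; apply: walk_edge.
Qed.

Lemma reduced_nil G : reduced G [::].
Proof. by case. Qed.

Lemma reduced1 G e : reduced G [:: e].
Proof. by case=> [|? []]. Qed.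

Lemma reduced_cons2 G e f p :
  reduced G [:: e, f & p] <-> f <> rev G e /\ reduced G (f :: p).
Proof.
split=> [r|[nfe r] [|a p1] e' f' p2 /=].
- split; first exact: (r [::] e f p).
  by move=> p1 e' f' p2 ep; apply: (r (e :: p1) _ _ p2); rewrite ep.
- by case=> <- <- _.
- by case=> _; exact: r.
Qed.

Lemma reduced_behead G e p : reduced G (e :: p) -> reduced G p.
Proof.
case: p => [|f p]; first by move=> _; exact: reduced_nil.
by case/reduced_cons2.
Qed.

Lemma reduced_catl G p q : reduced G (p ++ q) -> reduced G p.
Proof. by move=> r p1 e f p2 ep; apply: (r p1 e f (p2 ++ q)); rewrite ep -catA. Qed.

Lemma reduced_glue G p e f q : reduced G (p ++ [:: e]) -> reduced G (f :: q) ->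
  f <> rev G e -> reduced G (p ++ [:: e, f & q]).
Proof.
move=> + rq nfe; elim: p => [_|a p IH]; first exact/reduced_cons2.
case: p IH => [|b p] IH; rewrite /= !reduced_cons2.
  by move=> [ne _]; split=> //; exact: (IH (@reduced1 G e)).
by move=> [nb r]; split=> //; exact: IH.
Qed.

Lemma reduced_back G x p y : serre_graph G -> walk G x p y ->
  reduced G p -> reduced G (back G p).
Proof.
move=> sG; elim: p x => [//|e p IH x [Ge _ wp] r].
case: p wp IH r => [|f p] wp IH; first by move=> _; exact: reduced1.
move=> /reduced_cons2[nfe r]; move: (IH _ wp r).
rewrite !back_cons -catA /= => r'.
apply: reduced_glue r' _ _; first exact: reduced1.
by case: wp => Gf _ _; have [_ _ _ ->] := sG f Gf; apply: nesym.
Qed.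

(** The first edges at which two reduced walks with the same endpoints differ
    would start a reduced closed walk. *)
Lemma reduced_walk_unique G x y p q : serre_graph G -> acyclic G ->
  walk G x p y -> walk G x q y -> reduced G p -> reduced G q -> p = q.
Proof.
move=> sG aG; elim: p x q => [x q|e p IH x [|f q]].
- by move=> [vx <-] wq _ rq; rewrite (aG _ _ wq rq).
- by move=> wp [_ ex] rp _; rewrite -ex in wp; rewrite (aG _ _ wp rp).
move=> wp wq rp rq; have [ef|nef] := pselect (e = f).
  rewrite -ef in wq rq *; case: wp => _ _ wp; case: wq => _ _ wq.
  by rewrite (IH _ q wp wq (reduced_behead rp) (reduced_behead rq)).
have := aG y _ (walk_cat (walk_back sG wp) wq).
have := reduced_back sG wp rp; rewrite back_cons => rb.
rewrite -catA /= => cl.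
suff /cl : reduced G (back G p ++ [:: rev G e, f & q]) by case: (back G p).
apply: reduced_glue => //.
by case: wp => Ge _ _; have [_ _ _ ->] := sG e Ge; apply: nesym.
Qed.

Lemma not_reduced G p : ~ reduced G p ->
  exists p1 e p2, p = p1 ++ [:: e, rev G e & p2].
Proof.
move=> nr; apply: contrapT => h; apply: nr => p1 e f p2 ep ef.
by apply: h; exists p1, e, p2; rewrite ep ef.
Qed.

Lemma walk_reduce G x y p : serre_graph G -> walk G x p y ->
  exists2 q, walk G x q y & reduced G q.
Proof.
move=> sG; move: {2}(size p) (leqnn (size p)) => n.
elim: n p => [|n IH] p szp wp.
  by exists p => //; case: p szp {wp} => // _; exact: reduced_nil.
have [r|/not_reduced[p1 [e [p2 ep]]]] := pselect (reduced G p); first by exists p.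
move: wp; rewrite ep => /(walk_catP sG)[z w1 /= [Ge se [_ _ w2]]].
apply: (IH (p1 ++ p2)).
  by move: szp; rewrite ep !size_cat /= !addnS ltnS => /ltnW.
apply: walk_cat w1 _; have [_ tr] := serre_tgt sG Ge.
by rewrite -se -tr.
Qed.

Lemma walk_map (V' E' : Type) G (G' : graph V' E') (a : V -> V') (b : E -> E') x p y :
  (forall z, verts G z -> verts G' (a z)) ->
  (forall e, edges G e ->
     [/\ edges G' (b e), src G' (b e) = a (src G e) & tgt G' (b e) = a (tgt G e)]) ->
  walk G x p y -> walk G' (a x) (map b p) (a y).
Proof.
move=> av be; elim: p x => [x [vx <-]|e p IH x [Ge <- /IH w]] /=.
  by split=> //; exact: av.
by have [ge -> ->] := be e Ge.
Qed.

Lemma serre_induced G A : serre_graph G -> serre_graph (induced G A).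
Proof.
move=> sG e /= [Ge As At]; have [vs Gr sr rr] := sG e Ge.
have [_ tr] := serre_tgt sG Ge.
by split=> //; split; rewrite ?sr ?tr.
Qed.

Lemma walk_induced G A x p y : walk (induced G A) x p y -> walk G x p y.
Proof. by elim: p x => [x [[vx _] <-]//|e p IH x /= [[Ge _ _] se /IH]]. Qed.

Lemma acyclic_induced G A : acyclic G -> acyclic (induced G A).
Proof. by move=> aG x p /walk_induced; exact: aG. Qed.

Lemma induced_induced G A W : W `<=` A -> induced (induced G A) W = induced G W.
Proof.
move=> WA; rewrite /induced /=; congr Graph; apply/seteqP; split=> x /=.
- by case=> -[].
- by move=> [vx Wx]; do 2![split=> //]; exact: WA.
- by case=> -[].
- by move=> [Ge Ws Wt]; split=> //; split=> //; exact: WA.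
Qed.

Lemma induced_cap G A W : induced (induced G A) W = induced G (A `&` W).
Proof.
rewrite /induced /= setIA; congr Graph; apply/seteqP.
by split=> e /= [] => [[Ge As At] Ws Wt|Ge [As Ws] [At Wt]].
Qed.

Lemma induced_full G A : verts G `<=` A -> serre_graph G -> induced G A = G.
Proof.
move=> GA sG; case: G GA sG => v ed s t r /= GA sG; rewrite /induced /=.
congr Graph; apply/seteqP; split=> x /=.
- by case.
- by move=> vx; split=> //; exact: GA.
- by case.
move=> Ge; have [vs _ _ _] := sG x Ge; have [vt _] := serre_tgt sG Ge.
by split=> //; exact: GA.
Qed.

(** A reduced walk inside the subtree has the same endpoints, so it is the same walk. *)
Lemma subtree_convex G W x y p : serre_graph G -> acyclic G ->
  connected (induced G W) -> W x -> W y ->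
  walk G x p y -> reduced G p -> walk (induced G W) x p y.
Proof.
move=> sG aG cW Wx Wy wp rp.
have [q wq] : exists p, walk (induced G W) x p y.
  by apply: cW; split=> //; [exact: walk_src wp|exact: walk_tgt wp].
have [q' wq' rq'] := walk_reduce (serre_induced (A := W) sG) wq.
by rewrite (reduced_walk_unique sG aG wp (walk_induced wq') rp rq').
Qed.

(** By convexity, the reduced walk between two common vertices lies in each of the
    subtrees. *)
Lemma bigcap_connected G (P : set V -> Prop) : serre_graph G -> acyclic G ->
  connected G -> (forall W, P W -> connected (induced G W)) ->
  connected (induced G [set x | forall W, P W -> W x]).
Proof.
move=> sG aG cG cP x y [vx Px] [vy Py].
have [p wp] := cG x y vx vy; have [q wq rq] := walk_reduce sG wp.
have wW W : P W -> walk (induced G W) x q y.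
  by move=> PW; apply: subtree_convex => //; [exact: cP|exact: Px|exact: Py].
exists q; elim: q x {vx Px wp rq} wq wW => [x [vx <-] wW|e q IH x [Ge se wq] wW] /=.
  by split=> //; split=> // W /wW [[]].
split=> //.
- by split=> // W /wW /= [[]].
- by apply: IH => // W /wW /= [].
Qed.

(** A reduced walk cannot pass through an end vertex of the graph. *)
Lemma remove_end_vertex G y : serre_graph G -> connected G ->
  (forall e f, edges G e -> edges G f -> src G e = y -> src G f = y -> e = f) ->
  connected (induced G [set x | x <> y]).
Proof.
move=> sG cG ly x z [vx nx] [vz nz].
have [p wp] := cG x z vx vz; have [q wq rq] := walk_reduce sG wp.
exists q; elim: q x vx nx wq rq {p wp} => [|e q IH] x vx nx.
  by case=> _ <-.
move=> /= [Ge se wq] rq.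
have nt : tgt G e <> y.
  case: q wq rq {IH} => [[_ te] _|f q /= [Gf sf _] /reduced_cons2[nfe _] te].
    by rewrite te.
  have [_ Gr sr _] := sG e Ge.
  by apply: nfe; apply: ly => //; rewrite ?sf ?sr.
split=> //; first by rewrite /= se.
apply: IH => //; last exact: reduced_behead rq.
by have [] := serre_tgt sG Ge.
Qed.

(** A walk leaving the subtree [T] can be continued for ever when there are no end
    vertices.  It never meets [T] again, by convexity, so its end is not one of [T]. *)
Lemma leafless_same_ends G T : serre_graph G -> acyclic G -> connected G ->
  (forall e, edges G e -> exists2 f, edges G f /\ src G f = tgt G e & f <> rev G e) ->
  is_tree (induced G T) -> same_ends G (induced G T) -> verts G `<=` T.
Proof.
move=> sG aG cG nl [[t [vt Tt]] cT _] sE x vx; apply: contrapT => nTx.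
have [e0 [Ge0 Ts0 nTt0]] : exists e, [/\ edges G e, T (src G e) & ~ T (tgt G e)].
  have [p] := cG t x vt vx; elim: p t Tt {vt} => [t Tt [_ tx]|e p IH t Tt /= [Ge se wp]].
    by rewrite tx in Tt.
  have [Te|nTe] := pselect (T (tgt G e)); first exact: IH wp.
  by exists e; split=> //; rewrite se.
have nlP e : exists f, edges G e -> [/\ edges G f, src G f = tgt G e & f <> rev G e].
  have [/nl[f [Gf sf] nf]|ne] := pselect (edges G e); first by exists f.
  by exists e.
have [next nextP] := choice nlP.
pose c i := iter i next e0.
have Gc i : edges G (c i) by elim: i => [//|i /nextP[]].
have hc : halfline G c.
  by move=> i; have [_ s n] := nextP _ (Gc i); split=> //=; rewrite s.
have [d hd [m [n cd]]] := sE c hc.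
have [Tm _ _] := hd n; have := cd 0; rewrite !addn0 => cdm.
rewrite -cdm /= in Tm; case: Tm => _ Tsm Ttm.
have wc : walk G (src G e0) (map c (iota 0 m)) (src G (c m)).
  elim: m {cd cdm Tsm Ttm} => [|m IH]; first by split=> //; have [] := sG e0 Ge0.
  rewrite -addn1 iotaD map_cat; apply: walk_cat IH _ => /=.
  have [Gm _ _] := hc m; rewrite addn1 add0n; split=> //.
  have [_ <- _] := hc m; split=> //; by have [] := serre_tgt sG Gm.
have rc : reduced G (map c (iota 0 m)).
  elim: m 0%N {cd cdm Tsm Ttm wc} => [//|m IH] i; first exact: reduced_nil.
  case: m IH => [|m] IH; first exact: reduced1.
  by apply/reduced_cons2; split; [have [_ _] := hc i|exact: IH].
have := subtree_convex sG aG cT Ts0 Tsm wc rc.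
by case: m {wc rc cd cdm Tsm} Ttm => [/nTt0|m _ [[_ _ /nTt0]]].
Qed.

End GraphTheory.

(** * Groups acting on trees *)

(** The laws are required at the vertices and edges of [G] only: projectivities act
    on similarity classes of lattices, but their chosen matrices do not compose on
    arbitrary families of sets of vectors. *)
Record graph_action (V E : Type) (gT : groupType) (actV : gT -> V -> V)
    (actE : gT -> E -> E) (G : graph V E) (N : set gT) : Prop := {
  ga_1 : N 1%g;
  ga_M : forall m n, N m -> N n -> N (m * n)%g;
  ga_V : forall n, N n -> N n^-1%g;
  ga_verts : forall n x, N n -> verts G x -> verts G (actV n x);
  ga_edges : forall n e, N n -> edges G e -> edges G (actE n e);
  ga_src : forall n e, N n -> edges G e -> src G (actE n e) = actV n (src G e);
  ga_tgt : forall n e, N n -> edges G e -> tgt G (actE n e) = actV n (tgt G e);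
  ga_rev : forall n e, N n -> edges G e -> rev G (actE n e) = actE n (rev G e);
  ga_1v : forall x, verts G x -> actV 1%g x = x;
  ga_1e : forall e, edges G e -> actE 1%g e = e;
  ga_Mv : forall m n x, N m -> N n -> verts G x ->
    actV (m * n)%g x = actV m (actV n x);
  ga_Me : forall m n e, N m -> N n -> edges G e ->
    actE (m * n)%g e = actE m (actE n e) }.

Section BassSerre.
Variables (V E : Type) (gT : groupType).
Variables (actV : gT -> V -> V) (actE : gT -> E -> E).
Variables (G : graph V E) (N : set gT) (D : set V).
Hypotheses (sG : serre_graph G) (aN : graph_action actV actE G N).
Hypothesis hD : is_section actV actE G N D.

Lemma section_verts x : D x -> verts G x.
Proof. by case: hD => DG _ _ _; exact: DG. Qed.

Lemma act_vertex_inv n x y : N n -> verts G x -> y = actV n x -> actV n^-1%g y = x.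
Proof.
move=> Nn vx ->; rewrite -(ga_Mv aN) ?mulVg ?(ga_1v aN) //.
exact: (ga_V aN).
Qed.

Lemma act_edge_inv n e f : N n -> edges G e -> f = actE n e -> actE n^-1%g f = e.
Proof.
move=> Nn ve ->; rewrite -(ga_Me aN) ?mulVg ?(ga_1e aN) //.
exact: (ga_V aN).
Qed.

Lemma section_vertex_uniq x n : D x -> N n -> D (actV n x) -> actV n x = x.
Proof.
case: hD => DG _ hv _ Dx Nn Dnx.
have [y [_ yP]] := hv _ (ex_intro2 _ _ x (DG x Dx) erefl).
rewrite -[RHS](yP x); last first.
  by split=> //; exists 1%g; [exact: (ga_1 aN)|rewrite (ga_1v aN) //; exact: DG].
by apply: esym; apply: yP; split=> //; exists n.
Qed.

Lemma section_edge e : edges G e ->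
  exists f n, [/\ edges (induced G D) f, N n & e = actE n f].
Proof.
case: hD => _ _ _ he Ge.
have [f [[Df [n Nn nf]] _]] := he _ (ex_intro2 _ _ e Ge erefl).
exists f, n^-1%g; split=> //; first exact: (ga_V aN).
by rewrite (act_edge_inv Nn Ge (esym nf)).
Qed.

Lemma section_edge_uniq e n : edges (induced G D) e -> N n ->
  edges (induced G D) (actE n e) -> actE n e = e.
Proof.
case: hD => _ _ _ he De Nn Dne; have [Ge _ _] := De.
have [f [_ fP]] := he _ (ex_intro2 _ _ e Ge erefl).
rewrite -[RHS](fP e); last first.
  by split=> //; exists 1%g; [exact: (ga_1 aN)|rewrite (ga_1e aN)].
by apply: esym; apply: fP; split=> //; exists n.
Qed.

Let stabv x n := N n /\ actV n x = x.
Let stabe e n := N n /\ actE n e = e.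

Lemma stabM x m n : verts G x -> stabv x m -> stabv x n -> stabv x (m * n)%g.
Proof.
move=> vx [Nm mx] [Nn nx]; split; first exact: (ga_M aN).
by rewrite (ga_Mv aN) // nx.
Qed.

Lemma stab1 x : verts G x -> stabv x 1%g.
Proof. by move=> vx; split; [exact: (ga_1 aN)|exact: (ga_1v aN)]. Qed.

Lemma stabe_src e n : edges G e -> stabe e n -> stabv (src G e) n.
Proof. by move=> Ge [Nn ne]; split=> //; rewrite -(ga_src aN) // ne. Qed.

(** These walks in the section encode the words in the vertex groups: each step
    carries an element of the stabilizer of the vertex that is left.  The translates
    of the edges by the successive partial products form a walk in the whole graph. *)
Fixpoint decorated_walk x (l : seq (gT * E)) y : Prop :=
  if l is (s, e) :: l' then
    [/\ stabv x s, edges (induced G D) e, src G e = x & decorated_walk (tgt G e) l' y]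
  else D x /\ x = y.

Definition product (l : seq (gT * E)) : gT := foldr (fun a m => a.1 * m)%g 1%g l.

Fixpoint unfold_walk m (l : seq (gT * E)) : seq E :=
  if l is (s, e) :: l' then actE (m * s)%g e :: unfold_walk (m * s)%g l' else [::].

Lemma product_cat l1 l2 : product (l1 ++ l2) = (product l1 * product l2)%g.
Proof. by elim: l1 => [|a l IH] /=; rewrite ?mul1g // IH mulgA. Qed.

Lemma decorated_walk_cat x y z l1 l2 : decorated_walk x l1 y ->
  decorated_walk y l2 z -> decorated_walk x (l1 ++ l2) z.
Proof.
elim: l1 x => [x [_ ->]//|[s e] l IH x [xs De se w1] w2] /=.
by split=> //; exact: IH.
Qed.

Lemma decorated_walk_catP x z l1 l2 : decorated_walk x (l1 ++ l2) z ->
  exists2 y, decorated_walk x l1 y & decorated_walk y l2 z.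
Proof.
elim: l1 x => [x wq|[s e] l IH x /= [xs De se /IH[y w1 w2]]]; last by exists y.
exists x => //; split=> //.
by case: l2 wq => [[]|[s e] l [_ [_ Ds _] <- _]].
Qed.

Lemma decorated_walk_src x l y : decorated_walk x l y -> D x.
Proof. by case: l => [[]|[s e] l [_ [_ Ds _] <- _]]. Qed.

Lemma decorated_walk_tgt x l y : decorated_walk x l y -> D y.
Proof. by elim: l x => [x [Dx <-]|[s e] l IH x [_ _ _ /IH]]. Qed.

Lemma productN x l y : decorated_walk x l y -> N (product l).
Proof.
elim: l x => [|[s e] l IH] x /=; first by move=> _; exact: (ga_1 aN).
by case=> -[Ns _] _ _ /IH; exact: (ga_M aN).
Qed.

Lemma walk_unfold m x l y : N m -> decorated_walk x l y ->
  walk G (actV m x) (unfold_walk m l) (actV (m * product l)%g y).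
Proof.
elim: l x m => [|[s e] l IH] x m Nm /=.
  move=> [Dx <-]; rewrite mulg1; split=> //.
  by apply: (ga_verts aN) => //; exact: section_verts.
move=> [[Ns sx] [Ge Ds Dt] se w]; have Nms := ga_M aN Nm Ns.
split; first exact: (ga_edges aN).
  by rewrite (ga_src aN) // se (ga_Mv aN) ?sx // -se; apply: section_verts.
by rewrite (ga_tgt aN) // mulgA; exact: IH.
Qed.

(** Each edge of [G] is a translate of a unique edge of the section.  The quotients
    of the successive translating elements fix the vertices that are passed: they are
    the decorations. *)
Lemma fold_walk z p z' x m : walk G z p z' -> D x -> N m -> z = actV m x ->
  exists l y, decorated_walk x l y /\ z' = actV (m * product l)%g y.
Proof.
elim: p z x m => [z x m [_ <-] Dx Nm zx|e p IH z x m [Ge se wp] Dx Nm zx].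
  by exists [::], x; rewrite /= mulg1.
have [e0 [n [De0 Nn ee]]] := section_edge Ge; have [Ge0 Ds0 Dt0] := De0.
have Nmi := ga_V aN Nm; have Ns := ga_M aN Nmi Nn.
have sx : actV (m^-1 * n)%g (src G e0) = x.
  rewrite (ga_Mv aN) //; last exact: section_verts.
  by rewrite -(ga_src aN) // -ee se; apply: act_vertex_inv => //; exact: section_verts.
have s0x : src G e0 = x.
  by rewrite -sx; symmetry; apply: section_vertex_uniq => //; rewrite sx.
have [l [y [wl zy]]] := IH _ _ n wp Dt0 Nn
  (etrans (congr1 _ ee) (ga_tgt aN Nn Ge0)).
exists ((m^-1 * n, e0)%g :: l), y; split; last by rewrite /= mulgA mulVKg.
by split=> //; split=> //; rewrite -{1}s0x.
Qed.

Lemma unfold_walk_split m l p1 e f p2 : unfold_walk m l = p1 ++ [:: e, f & p2] ->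
  exists l1 s1 e1 s2 e2 l2, [/\ l = l1 ++ [:: (s1, e1), (s2, e2) & l2],
    e = actE (m * product l1 * s1)%g e1 & f = actE (m * product l1 * s1 * s2)%g e2].
Proof.
elim: l m p1 => [m [|? ?]//|[s a] l IH m [|b p1]] /=.
  case: l {IH} => [//|[s' a'] l] /= [<- <- _].
  by exists [::], s, a, s', a', l; rewrite /= !mulg1.
case=> _ /IH[l1 [s1 [e1 [s2 [e2 [l2 [-> -> ->]]]]]]].
by exists ((s, a) :: l1), s1, e1, s2, e2, l2; split; rewrite //= !mulgA.
Qed.

(** Absorbing an element of the stabilizer of the first vertex; [t] decorates
    the last vertex. *)
Definition push u (l : seq (gT * E)) t : seq (gT * E) * gT :=
  if l is (s, e) :: l' then ((u * s, e)%g :: l', t) else ([::], u * t)%g.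

Section Compatible.
Variables (H : groupType) (f : V -> gT -> H).
Hypothesis fM : forall x, D x -> hom_on (stabv x) (f x).
Hypothesis fE : forall e, edges (induced G D) e -> forall n, stabe e n ->
  f (src G e) n = f (tgt G e) n.

Definition value l : H := foldr (fun a m => f (src G a.2) a.1 * m)%g 1%g l.

Lemma value_cat l1 l2 : value (l1 ++ l2) = (value l1 * value l2)%g.
Proof. by elim: l1 => [|a l IH] /=; rewrite ?mul1g // IH mulgA. Qed.

Lemma compatible1 x : D x -> f x 1%g = 1%g.
Proof.
move=> Dx; have x1 := stab1 (section_verts Dx).
by apply: (mulgI (f x 1%g)); rewrite -fM // !mulg1.
Qed.

Lemma pushP x y u l t : stabv x u -> decorated_walk x l y -> stabv y t ->
  let l' := (push u l t).1 in let t' := (push u l t).2 in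
  [/\ decorated_walk x l' y, stabv y t', product l' * t' = u * (product l * t),
      value l' * f y t' = f x u * (value l * f y t) & size l' = size l]%g.
Proof.
case: l => [|[s e] l] /= xu.
  move=> [Dx <-] xt; rewrite !mul1g fM //; split=> //.
  by apply: stabM => //; exact: section_verts.
move=> [xs De se wl] yt; have Dx : D x by rewrite -se; case: De.
rewrite !mulgA se fM //; split=> //.
case: De => Ge _ Dt; split=> //; apply: stabM => //; exact: section_verts.
Qed.

(** The unfolded walk is closed, hence it backtracks somewhere.  There the decoration
    lies in an edge group; as the homomorphisms agree on the edge groups, it can be
    moved across the edge, which shortens the walk without changing its value. *)
Lemma trivial_product x l t : acyclic G -> decorated_walk x l x -> stabv x t ->
  (product l * t = 1)%g -> (value l * f x t = 1)%g.
Proof.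
move=> aG; move: {2}(size l) (leqnn (size l)) => n.
elim: n l t => [|n IH] l t.
  by case: l => [|//] _ [Dx _] _ /=; rewrite !mul1g => ->; exact: compatible1.
move=> szl wl xt lt1; have Dx := decorated_walk_src wl.
have vx := section_verts Dx.
have [l0|ln0] := pselect (l = [::]).
  by apply: IH => //; rewrite l0.
have wu : walk G x (unfold_walk 1%g l) x.
  have := walk_unfold (ga_1 aN) wl; rewrite (ga_1v aN) // mul1g.
  suff -> : actV (product l) x = x by [].
  have Nl := productN wl; case: xt => Nt tx.
  by rewrite -{1}tx -(ga_Mv aN) // lt1 (ga_1v aN).
have : ~ reduced G (unfold_walk 1%g l).
  by move=> /(aG _ _ wu); case: (l) ln0 => [//|[]].
case/not_reduced => p1 [e [p2]] /unfold_walk_split.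
move=> [l1 [s1 [e1 [s2 [e2 [l2 [el ee ef]]]]]]].
move: wl szl lt1; rewrite el => /decorated_walk_catP[y w1].
move=> [] y1 De1 sy [] y2 De2 s2y w2 szl lt1.
have [[Ge1 Ds1 Dt1] [Ge2 Ds2 Dt2]] := (De1, De2).
have [Ns1 Ns2] := (y1.1, y2.1); have Nl1 := productN w1.
have Dy := decorated_walk_tgt w1.
have re : rev G e1 = actE s2 e2.
  have Nm : N (1 * product l1 * s1)%g by rewrite mul1g; exact: (ga_M aN).
  move: ef; rewrite ee (ga_rev aN Nm Ge1) (ga_Me aN Nm Ns2 Ge2) => ef.
  have [_ Gr1 _ _] := sG Ge1.
  rewrite -(act_edge_inv Nm Gr1 erefl) ef.
  by apply: act_edge_inv => //; exact: (ga_edges aN).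
have Dr : edges (induced G D) (rev G e1).
  by have [_ ? _ _] := serre_induced (A := D) sG De1.
have e2E : e2 = rev G e1.
  by rewrite re section_edge_uniq // -re.
have s2e : stabe e1 s2.
  split=> //; have [_ Gr1 _ rr] := sG Ge1.
  by rewrite -{1}rr -(ga_rev aN) // -e2E -re rr.
have te2 : tgt G e2 = y by rewrite e2E; have [_ ->] := serre_tgt sG Ge1.
rewrite te2 in w2.
have ys2 : stabv y s2 by rewrite -sy; exact: stabe_src s2e.
have [w' xt' pr im sz] := pushP (stabM (section_verts Dy) y1 ys2) w2 xt.
have := IH (l1 ++ (push (s1 * s2)%g l2 t).1) (push (s1 * s2)%g l2 t).2.
rewrite product_cat value_cat -!mulgA pr im => IH'.
rewrite value_cat /= sy -!mulgA s2y -fE //= sy -IH'.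
- by rewrite fM // -!mulgA.
- by move: szl; rewrite !size_cat sz /= !addnS ltnS => /ltnW.
- exact: decorated_walk_cat w1 w'.
- exact: xt'.
- by move: lt1; rewrite product_cat /= -!mulgA.
Qed.

(** For [x = y], this is the graph of the homomorphism to be constructed. *)
Definition represents x y n (h : H) := exists l t,
  [/\ decorated_walk x l y, stabv y t, n = (product l * t)%g
    & h = (value l * f y t)%g].

Lemma represents_mul x y z m n h h' : represents x y m h ->
  represents y z n h' -> represents x z (m * n)%g (h * h')%g.
Proof.
move=> [l [t [wl yt -> ->]]] [l' [t' [wl' zt' -> ->]]].
have [w zt pr im _] := pushP yt wl' zt'.
exists (l ++ (push t l' t').1), (push t l' t').2; split=> //.
- exact: decorated_walk_cat wl w.
- by rewrite product_cat -!mulgA pr.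
- by rewrite value_cat -!mulgA im.
Qed.

Lemma represents_stab x s : D x -> stabv x s -> represents x x s (f x s).
Proof. by move=> Dx xs; exists [::], s; rewrite /= !mul1g. Qed.

Lemma represents_path x y : D x -> D y -> represents x y 1%g 1%g.
Proof.
case: hD => DG [_ cD _] _ _ Dx Dy.
have [p] := cD x y (conj (DG x Dx) Dx) (conj (DG y Dy) Dy).
elim: p x Dx => [x Dx [_ <-]|e p IH x Dx [De se wp]].
  rewrite -[X in represents _ _ _ X](compatible1 Dx).
  by apply: represents_stab => //; apply/stab1/DG.
have Dt : D (tgt G e) by case: De.
have [l [t [w yt p1 i1]]] := IH _ Dt wp.
exists ((1%g, e) :: l), t; split=> //=.
- by split=> //; apply/stab1/DG.
- by rewrite mul1g.
- by rewrite se compatible1 // mul1g.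
Qed.

Lemma represents_total x n : connected G -> D x -> N n -> exists h, represents x x n h.
Proof.
move=> cG Dx Nn; have vx := section_verts Dx.
have [p wp] := cG x (actV n x) vx (ga_verts aN Nn vx).
have [l [y [wl]]] := fold_walk wp Dx (ga_1 aN) (esym (ga_1v aN vx)).
rewrite mul1g => nxy.
have Dy := decorated_walk_tgt wl; have Nl := productN wl.
have Nli := ga_V aN Nl; have vy := section_verts Dy.
have lnx : actV ((product l)^-1 * n)%g x = y.
  by rewrite (ga_Mv aN) //; exact: act_vertex_inv.
have yx : y = x.
  by rewrite -lnx section_vertex_uniq ?lnx //; exact: (ga_M aN).
rewrite yx in wl lnx; exists (value l * f x ((product l)^-1 * n))%g.
exists l, ((product l)^-1 * n)%g; split=> //; last by rewrite mulVKg.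
by split=> //; exact: (ga_M aN).
Qed.

(** Multiplying by a representation of the inverse reduces the claim to words with
    trivial product. *)
Lemma represents_uniq x n h h' : acyclic G -> connected G -> D x -> N n ->
  represents x x n h -> represents x x n h' -> h = h'.
Proof.
move=> aG cG Dx Nn rh rh'; have [g rg] := represents_total cG Dx (ga_V aN Nn).
have inv h1 : represents x x n h1 -> (g * h1 = 1)%g.
  move=> /(represents_mul rg)[l [t [wl xt]]]; rewrite mulVg => e ->.
  exact: trivial_product.
by apply: (mulgI g); rewrite (inv h) // (inv h').
Qed.

End Compatible.

(** Serre: connectedness of [G] makes every element of [N] a product along a decorated
    walk, and acyclicity makes the corresponding product in [H] independent of that
    walk. *)
Theorem section_amalgam : acyclic G -> connected G ->
  is_amalgam (stabilizer_tree actV actE G N D) N.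
Proof.
move=> aG cG; split=> [x _ n []//|H f fM' fE' ext].
have fM x : D x -> hom_on (stabv x) (f x).
  by move=> Dx; apply: fM'; split=> //; exact: section_verts.
have [x0 [_ D0]] : verts (induced G D) !=set0 by case: hD => _ [].
have hP n : exists h, N n -> represents f x0 x0 n h.
  have [Nn|nN] := pselect (N n); last by exists 1%g.
  by have [h rh] := represents_total f cG D0 Nn; exists h.
have [h {}hP] := choice hP.
have huniq n g : N n -> represents f x0 x0 n g -> h n = g.
  by move=> Nn; apply: represents_uniq => //; exact: hP.
exists h => [|h' [h'M h'f] n Nn].
  split=> [m n Nm Nn|x [_ Dx] n [Nn nx]].
    apply: huniq; first exact: (ga_M aN).
    by apply: represents_mul => //; exact: hP.
  apply: huniq => //.
  have p1 := represents_path fM D0 Dx; have p2 := represents_path fM Dx D0.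
  have ps := represents_stab f Dx (conj Nn nx).
  by have := represents_mul fM (represents_mul fM p1 ps) p2; rewrite !mul1g !mulg1.
have [l [t [wl xt en ->]]] := hP n Nn; rewrite en.
have h'D x s : D x -> stabv x s -> h' s = f x s.
  by move=> Dx; apply: h'f; split=> //; exact: section_verts.
have [Nl Nt] := (productN wl, xt.1); rewrite h'M ?(h'D x0 t) //.
congr (_ * _)%g; elim: l {1}x0 {en Nl} wl => [x [Dx _]|[s e] l IH x] /=.
  by rewrite (h'D x) ?(compatible1 fM) //; apply: stab1; exact: section_verts.
move=> [xs De se wl]; have Dx : D x by rewrite -se; case: De.
by have [Ns Nl] := (xs.1, productN wl); rewrite h'M ?(IH _ wl) ?(h'D x s) ?se //.
Qed.

End BassSerre.

(** * Two by two matrices over a valued field *)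

Section Mat2.
Variable R : comNzRingType.
Implicit Types A B : 'M[R]_2.

Definition mat2 (a b c d : R) : 'M[R]_2 :=
  \matrix_(i, j) (if i == 0 then if j == 0 then a else b
                  else if j == 0 then c else d).

Definition col2 (x y : R) : 'cV[R]_2 := \col_i (if i == 0 then x else y).

Lemma ord2P (P : 'I_2 -> Prop) : P 0 -> P 1 -> forall i, P i.
Proof.
move=> P0 P1 [[|[|//]] i2]; first by rewrite (_ : Ordinal i2 = 0) //; apply/val_inj.
by rewrite (_ : Ordinal i2 = 1) //; apply/val_inj.
Qed.

Lemma mat2E a b c d : [/\ mat2 a b c d 0 0 = a, mat2 a b c d 0 1 = b,
  mat2 a b c d 1 0 = c & mat2 a b c d 1 1 = d].
Proof. by rewrite !mxE. Qed.

Lemma mat2_eta A : A = mat2 (A 0 0) (A 0 1) (A 1 0) (A 1 1).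
Proof. by apply/matrixP; elim/ord2P; elim/ord2P; rewrite mxE. Qed.

Lemma col2_eta (u : 'cV[R]_2) : u = col2 (u 0 0) (u 1 0).
Proof. by apply/matrixP; elim/ord2P => j; rewrite mxE ord1. Qed.

Lemma mul_mat2 a b c d a' b' c' d' : mat2 a b c d *m mat2 a' b' c' d' =
  mat2 (a * a' + b * c') (a * b' + b * d') (c * a' + d * c') (c * b' + d * d').
Proof.
by apply/matrixP; elim/ord2P; elim/ord2P; rewrite !mxE !big_ord_recl big_ord0 !mxE addr0.
Qed.

Lemma mul_mat2_col2 a b c d x y :
  mat2 a b c d *m col2 x y = col2 (a * x + b * y) (c * x + d * y).
Proof.
by apply/matrixP; elim/ord2P => j; rewrite !mxE !big_ord_recl big_ord0 !mxE addr0.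
Qed.

Lemma scale_mat2 e a b c d : e *: mat2 a b c d = mat2 (e * a) (e * b) (e * c) (e * d).
Proof. by apply/matrixP; elim/ord2P; elim/ord2P; rewrite !mxE. Qed.

Lemma scale_col2 e x y : e *: col2 x y = col2 (e * x) (e * y).
Proof. by apply/matrixP; elim/ord2P => j; rewrite !mxE. Qed.

Lemma mat2_1 : 1%:M = mat2 1 0 0 1.
Proof. by apply/matrixP; elim/ord2P; elim/ord2P; rewrite !mxE. Qed.

Lemma col_mat2 a b c d : col 0 (mat2 a b c d) = col2 a c /\ col 1 (mat2 a b c d) = col2 b d.
Proof. by split; apply/matrixP; elim/ord2P => j; rewrite !mxE. Qed.

Lemma det_mat2 a b c d : \det (mat2 a b c d) = a * d - b * c.
Proof.
rewrite (expand_det_row _ 0) !big_ord_recl big_ord0 /cofactor !det_mx11 !mxE /=.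
by rewrite expr0 expr1; ring.
Qed.

Lemma adj_mat2 a b c d : \adj (mat2 a b c d) = mat2 d (- b) (- c) a.
Proof.
apply/matrixP; elim/ord2P; elim/ord2P; rewrite !mxE /cofactor !det_mx11 !mxE /=;
  by rewrite ?expr0 ?expr1 ?expr2; ring.
Qed.

End Mat2.

Section Valuation.
Variables (k : fieldType) (v : k -> int).
Hypothesis hv : discrete_valuation v.
Implicit Types (x y : k) (n : int).

Lemma valuation1 : v 1 = 0.
Proof.
have := valuationM hv (oner_neq0 k) (oner_neq0 k).
by rewrite (mulr1 (1 : k)); set a := v 1; lia.
Qed.

Lemma valuation_root1 x : x != 0 -> x * x = 1 -> v x = 0.
Proof. by move=> x0 xx; have := valuationM hv x0 x0; rewrite xx valuation1; lia. Qed.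

Lemma valuationV x : x != 0 -> v x^-1 = - v x.
Proof.
move=> x0; have := valuationM hv x0 (invr_neq0 x0).
by rewrite divff // valuation1; lia.
Qed.

Lemma valuationN x : x != 0 -> v (- x) = v x.
Proof.
move=> x0; rewrite -mulN1r (valuationM hv) ?oppr_eq0 ?oner_neq0 //.
by rewrite (@valuation_root1 (-1)) ?add0r ?oppr_eq0 ?oner_neq0 //; ring.
Qed.

Lemma val_geE n x : x != 0 -> val_ge v n x = (n <= v x).
Proof. by rewrite /val_ge => /negPf ->. Qed.

Lemma val_ge0 n : val_ge v n 0.
Proof. by rewrite /val_ge eqxx. Qed.

Lemma val_geW m n x : m <= n -> val_ge v n x -> val_ge v m x.
Proof. by rewrite /val_ge; case: eqP => //= _; lia. Qed.

Lemma val_geD n x y : val_ge v n x -> val_ge v n y -> val_ge v n (x + y).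
Proof.
have [->|x0] := eqVneq x 0; first by rewrite add0r.
have [->|y0] := eqVneq y 0; first by rewrite addr0.
have [->|xy0] := eqVneq (x + y) 0; first by rewrite val_ge0.
rewrite !val_geE // => nx ny; apply: le_trans (valuationD hv x0 y0 xy0).
by rewrite le_min nx ny.
Qed.

Lemma val_geN n x : val_ge v n (- x) = val_ge v n x.
Proof.
have [->|x0] := eqVneq x 0; first by rewrite oppr0.
by rewrite !val_geE ?oppr_eq0 // valuationN.
Qed.

Lemma val_geB n x y : val_ge v n x -> val_ge v n y -> val_ge v n (x - y).
Proof. by move=> nx ny; apply: val_geD; rewrite ?val_geN. Qed.

Lemma val_geM m n x y : val_ge v m x -> val_ge v n y -> val_ge v (m + n) (x * y).
Proof.
have [->|x0] := eqVneq x 0; first by rewrite mul0r !val_ge0.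
have [->|y0] := eqVneq y 0; first by rewrite mulr0 !val_ge0.
by rewrite !val_geE ?mulf_neq0 // (valuationM hv x0 y0); exact: lerD.
Qed.

Lemma val_ge_mull n x y : x != 0 -> val_ge v n (x * y) = val_ge v (n - v x) y.
Proof.
move=> x0; have [->|y0] := eqVneq y 0; first by rewrite mulr0 !val_ge0.
by rewrite !val_geE ?mulf_neq0 // (valuationM hv x0 y0) lerBlDl.
Qed.

Lemma val_ge_eq0 x : (forall n : nat, val_ge v n%:Z x) -> x = 0.
Proof.
move=> h; apply/eqP; apply: contraT => x0.
by have := h (absz (v x + 1)); rewrite val_geE //; lia.
Qed.

Lemma val_ge_sum n (I : Type) (r : seq I) (F : I -> k) :
  (forall i, val_ge v n (F i)) -> val_ge v n (\sum_(i <- r) F i).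
Proof. by move=> nF; elim/big_ind: _ => //; [exact: val_ge0|exact: val_geD]. Qed.

Definition mx_ge n p q (A : 'M[k]_(p, q)) : Prop := forall i j, val_ge v n (A i j).

Lemma mx_geM m n p q r (A : 'M_(p, q)) (B : 'M_(q, r)) :
  mx_ge m A -> mx_ge n B -> mx_ge (m + n) (A *m B).
Proof.
by move=> mA nB i j; rewrite mxE; apply: val_ge_sum => l; exact: val_geM.
Qed.

Lemma mx_geW m n p q (A : 'M_(p, q)) : m <= n -> mx_ge n A -> mx_ge m A.
Proof. by move=> mn nA i j; exact: val_geW (nA i j). Qed.

Lemma mx_geD n p q (A B : 'M_(p, q)) : mx_ge n A -> mx_ge n B -> mx_ge n (A + B).
Proof. by move=> nA nB i j; rewrite mxE; exact: val_geD. Qed.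

Lemma mx_geN n p q (A : 'M_(p, q)) : mx_ge n A -> mx_ge n (- A).
Proof. by move=> nA i j; rewrite mxE val_geN. Qed.

Lemma mx_geB n p q (A B : 'M_(p, q)) : mx_ge n A -> mx_ge n B -> mx_ge n (A - B).
Proof. by move=> nA nB; apply: mx_geD => //; exact: mx_geN. Qed.

Lemma mx_geZ m n p q a (A : 'M_(p, q)) : val_ge v m a -> mx_ge n A -> mx_ge (m + n) (a *: A).
Proof. by move=> ma nA i j; rewrite mxE; exact: val_geM. Qed.

Lemma mx_ge_scale n p q a (A : 'M_(p, q)) : a != 0 ->
  mx_ge n (a *: A) <-> mx_ge (n - v a) A.
Proof. by move=> a0; split=> nA i j; have := nA i j; rewrite mxE val_ge_mull. Qed.

Lemma mx_ge_mat2 n a b c d : mx_ge n (mat2 a b c d) <->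
  [/\ val_ge v n a, val_ge v n b, val_ge v n c & val_ge v n d].
Proof.
split=> [h|[na nb nc nd]]; last by elim/ord2P; elim/ord2P; rewrite mxE.
by move: (h 0 0) (h 0 1) (h 1 0) (h 1 1); rewrite !mxE.
Qed.

Lemma mx_ge_col2 n x y : mx_ge n (col2 x y) <-> val_ge v n x /\ val_ge v n y.
Proof.
split=> [h|[nx ny]]; last by elim/ord2P => j; rewrite mxE.
by move: (h 0 0) (h 1 0); rewrite !mxE.
Qed.

Lemma mx_ge_bound p q (A : 'M[k]_(p, q)) : exists n, mx_ge n A.
Proof.
pose F (ij : 'I_p * 'I_q) := absz (v (A ij.1 ij.2)).
exists (- (\max_ij F ij)%N%:Z) => i j; rewrite /val_ge; case: eqP => //= _.
have : (F (i, j) <= \max_ij F ij)%N by exact: leq_bigmax.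
by rewrite {1}/F /=; lia.
Qed.

Lemma mx_ge_adj n (A : 'M[k]_2) : mx_ge n A -> mx_ge n (\adj A).
Proof.
rewrite (mat2_eta A) adj_mat2 => /mx_ge_mat2[a b c d].
by apply/mx_ge_mat2; rewrite !val_geN.
Qed.

Lemma invmx_adj (A : 'M[k]_2) : A \in unitmx -> invmx A = (\det A)^-1 *: \adj A.
Proof. by rewrite /invmx => ->. Qed.

Lemma unitmx_det (A : 'M[k]_2) : (A \in unitmx) = (\det A != 0).
Proof. by rewrite unitmxE unitfE. Qed.

Lemma mx_ge_det m (A : 'M[k]_2) : mx_ge m A -> val_ge v (m + m) (\det A).
Proof.
rewrite (mat2_eta A) det_mat2 => /mx_ge_mat2[a b c d].
by apply: val_geB; exact: val_geM.
Qed.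

Lemma mx_ge_inv n (A : 'M[k]_2) : A \in unitmx -> mx_ge n A ->
  mx_ge (n - v (\det A)) (invmx A).
Proof.
move=> uA nA; rewrite invmx_adj //; rewrite unitmx_det in uA.
apply/mx_ge_scale; first by rewrite invr_eq0.
by rewrite valuationV // opprK subrK; exact: mx_ge_adj.
Qed.

(** The group GL2(O). *)
Definition GLO (U : 'M[k]_2) : Prop := [/\ mx_ge 0 U, U \in unitmx & mx_ge 0 (invmx U)].

Lemma GLO_det U : GLO U -> v (\det U) = 0.
Proof.
case=> i0 uU i1; have := mx_ge_det i0; have := mx_ge_det i1.
rewrite det_inv; rewrite unitmx_det in uU.
rewrite !val_geE ?invr_eq0 // valuationV // addr0 oppr_ge0 => ge le.
by apply: le_anti; rewrite ge le.
Qed.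

Lemma GLO_of_det U : mx_ge 0 U -> U \in unitmx -> v (\det U) = 0 -> GLO U.
Proof.
move=> i0 uU vU; split=> //; have := mx_ge_inv uU i0.
by rewrite vU subr0.
Qed.

Lemma GLO_mul A B : GLO A -> GLO B -> GLO (A *m B).
Proof.
move=> [a ua ai] [b ub bi]; have uab : A *m B \in unitmx by rewrite unitmx_mul ua.
split=> //; first by rewrite -[0]addr0; exact: mx_geM.
rewrite (_ : invmx (A *m B) = invmx B *m invmx A).
  by rewrite -[0]addr0; exact: mx_geM.
apply: (can_inj (mulKmx uab)); rewrite mulmxV // -mulmxA (mulmxA B).
by rewrite mulmxV // mul1mx mulmxV.
Qed.

Lemma GLO_mat2 a b c d : val_ge v 0 a -> val_ge v 0 b -> val_ge v 0 c -> val_ge v 0 d ->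
  a * d - b * c != 0 -> v (a * d - b * c) = 0 -> GLO (mat2 a b c d).
Proof.
by move=> ? ? ? ? nz vz; apply: GLO_of_det; rewrite ?unitmx_det ?det_mat2 //; apply/mx_ge_mat2.
Qed.

(** The group k* GL2(O), which is the stabilizer of the class of the standard
    lattice. *)
Definition homothetic_GLO (M : 'M[k]_2) : Prop :=
  exists (c : k) (U : 'M[k]_2), [/\ c != 0, GLO U & M = c *: U].

Lemma homothetic_GLO_unit M : homothetic_GLO M -> M \in unitmx.
Proof. by case=> c [U [c0 [_ uU _] ->]]; rewrite unitmxZ ?unitfE. Qed.

Lemma GLO1 : GLO 1%:M.
Proof.
rewrite mat2_1; apply: GLO_mat2; rewrite ?val_ge0 ?val_geE ?oner_neq0 ?valuation1 //;
 by rewrite mulr1 mulr0 subr0 ?oner_neq0 ?valuation1.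
Qed.

End Valuation.

(** * The Bruhat-Tits tree *)

(** In a graph whose edges join each vertex to its parent, a reduced walk goes up and
    then down, so that it cannot come back to its origin. *)
Section RootedForest.
Variables (V E : Type) (G : graph V E) (par : V -> V -> Prop) (lev : V -> int).
Hypotheses (sG : serre_graph G)
  (edge_inj : forall e f, edges G e -> edges G f ->
    src G e = src G f -> tgt G e = tgt G f -> e = f)
  (edge_par : forall e, edges G e ->
    par (src G e) (tgt G e) \/ par (tgt G e) (src G e))
  (par_fun : forall x y z, verts G x -> par x y -> par x z -> y = z)
  (par_lev : forall x y, verts G x -> par x y -> lev x = lev y + 1).

Lemma edge_rev e f : edges G e -> edges G f ->
  src G f = tgt G e -> tgt G f = src G e -> f = rev G e.
Proof.
move=> Ge Gf s t; have [_ Gr sr _] := sG Ge; have [_ tr] := serre_tgt sG Ge.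
by apply: edge_inj => //; rewrite ?sr ?tr.
Qed.

Lemma descending_walk x e p y : walk G x (e :: p) y -> reduced G (e :: p) ->
  par (tgt G e) (src G e) -> lev x < lev y.
Proof.
elim: p x e => [|f p IH] x e /= [Ge se w] r pe.
  by case: w => vt <-; rewrite (par_lev vt pe) -se; lia.
have [vt _] := serre_tgt sG Ge; case: (w) => Gf sf _.
have lt : lev x < lev (tgt G e) by rewrite (par_lev vt pe) -se; lia.
have /reduced_cons2[nfe rf] := r.
have [pf|pf] := edge_par Gf; last exact: lt_trans lt (IH _ _ w rf pf).
case: nfe; apply: edge_rev => //.
by apply: (par_fun vt) pe; rewrite -sf.
Qed.

Lemma rooted_acyclic : acyclic G.
Proof.
move=> x p; move: {2}(size p) (leqnn (size p)) => n.
elim: n x p => [|n IH] x p; first by case: p.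
case: p => [//|e p] szp w r.
have [Ge se wp] := w; have vx := walk_src sG w.
have up : par (src G e) (tgt G e).
  have [//|pe] := edge_par Ge.
  by have := descending_walk w r pe; rewrite ltxx.
case/lastP: p => [|q f] in szp w r wp *.
  by move: wp => [_ te]; move: up; rewrite te se => /(par_lev vx); lia.
rewrite -cats1 in w r wp szp.
have [y wq [Gf sf [_ tf]]] := walk_catP sG wp.
have down : par (tgt G f) (src G f).
  have [pf|//] := edge_par Gf.
  have [_ _ sr _] := sG Gf; have [_ tr] := serre_tgt sG Gf.
  have := walk_back sG w; have := reduced_back sG w r.
  rewrite -cat_cons /back map_cat rev_cat /= => r' w'.
  by have := descending_walk w' r'; rewrite sr tr ltxx => /(_ pf).
have yt : y = tgt G e.
  rewrite tf in down; rewrite se in up; by rewrite -sf; exact: par_fun down up.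
rewrite yt in wq sf.
have q0 : q = [::].
  apply: IH wq _; first by move: szp; rewrite /= size_cat addn1 ltnS => /ltnW.
  by apply: (@reduced_catl _ _ _ _ [:: f]); exact: reduced_behead r.
move: r; rewrite q0 => /reduced_cons2[nf _]; case: nf.
by apply: edge_rev => //; rewrite tf.
Qed.

End RootedForest.

Section Lattices.
Variables (k : fieldType) (v : k -> int).
Hypothesis hv : discrete_valuation v.
Variable pi : k.
Hypotheses (pi0 : pi != 0) (vpi : v pi = 1).
Implicit Types (P A B : 'M[k]_2) (L : set 'cV[k]_2).

Lemma mem_lattice A u : A \in unitmx -> lattice_of v A u <-> mx_ge v 0 (invmx A *m u).
Proof.
move=> uA; split=> [[w wi <-]|h].
  by rewrite mulKmx // => i j; rewrite ord1; exact: wi.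
by exists (invmx A *m u); [move=> i; exact: h|rewrite mulKVmx].
Qed.

Lemma lattice_col A j : lattice_of v A (col j A).
Proof.
exists (delta_mx j 0); last by rewrite -colE.
move=> i; rewrite /integer_ring /= mxE.
by case: eqP => _; rewrite ?val_ge0 ?val_geE ?valuation1 ?oner_neq0.
Qed.

Lemma lattice_sub A B : A \in unitmx ->
  lattice_of v B `<=` lattice_of v A <-> mx_ge v 0 (invmx A *m B).
Proof.
move=> uA; split=> [h i j|h u [w wi <-]].
  have /h /(mem_lattice _ uA) := lattice_col B j.
  by move=> /(_ i 0); rewrite colE mulmxA -colE mxE.
apply/mem_lattice => //; rewrite mulmxA -[0]addr0; apply: mx_geM => //.
by move=> i j; rewrite ord1; exact: wi.
Qed.

Lemma lattice_mul_sub A B : A \in unitmx -> mx_ge v 0 B ->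
  lattice_of v (A *m B) `<=` lattice_of v A.
Proof. by move=> uA iB; apply/lattice_sub => //; rewrite mulKmx. Qed.

Lemma lattice_eq A B : A \in unitmx -> B \in unitmx ->
  lattice_of v A = lattice_of v B <-> GLO v (invmx A *m B).
Proof.
move=> uA uB; have uAB : invmx A *m B \in unitmx by rewrite unitmx_mul unitmx_inv uA.
have inv : invmx (invmx A *m B) = invmx B *m A.
  apply: (can_inj (mulKmx uAB)); rewrite mulmxV // -mulmxA (mulmxA B).
  by rewrite mulmxV // mul1mx mulVmx.
split=> [e|[i0 _ i1]].
  split=> //; first by apply/lattice_sub => //; rewrite e.
  by rewrite inv; apply/lattice_sub => //; rewrite e.
by apply/seteqP; split; apply/lattice_sub => //; rewrite -inv.
Qed.

Lemma lattice_GLO A U : A \in unitmx -> GLO v U ->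
  lattice_of v (A *m U) = lattice_of v A.
Proof.
move=> uA gU; apply/esym/lattice_eq => //; last by rewrite mulKmx.
by rewrite unitmx_mul uA; case: gU.
Qed.

Lemma lattice_scale c P :
  [set c *: u | u in lattice_of v P] = lattice_of v (c *: P).
Proof.
apply/seteqP; split=> u.
  by move=> [_ [w wi <-] <-]; exists w; rewrite // scalemxAl.
by move=> [w wi <-]; exists (P *m w); [exists w|rewrite scalemxAl].
Qed.

Definition vertex_of P : vertex k := similarity_class (lattice_of v P).

Lemma mem_vertex_of P L : vertex_of P L <-> exists2 c : k, c != 0 & L = lattice_of v (c *: P).
Proof.
by split=> [[c c0 <-]|[c c0 ->]]; exists c => //; rewrite lattice_scale.
Qed.

Lemma vertex_of_eq A B : A \in unitmx -> B \in unitmx ->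
  vertex_of A = vertex_of B <-> homothetic_GLO v (invmx A *m B).
Proof.
move=> uA uB; split=> [e|[c [U [c0 gU eU]]]].
  have [c c0 eA] : exists2 c : k, c != 0 & lattice_of v A = lattice_of v (c *: B).
    apply/mem_vertex_of; rewrite -e; apply/mem_vertex_of.
    by exists 1; rewrite ?oner_neq0 ?scale1r.
  have uc : c *: B \in unitmx by rewrite unitmxZ ?unitfE.
  exists c^-1, (invmx A *m (c *: B)); split; first by rewrite invr_eq0.
    exact/lattice_eq.
  by rewrite -scalemxAr scalerA mulVf // scale1r.
have eB : B = c *: (A *m U) by rewrite scalemxAr -eU mulKVmx.
have eqd d : d != 0 -> lattice_of v (d *: B) = lattice_of v ((d * c) *: A).
  move=> d0; rewrite eB scalerA scalemxAl lattice_GLO //.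
  by rewrite unitmxZ ?unitfE ?mulf_neq0.
apply/seteqP; split=> L /mem_vertex_of[d d0 ->]; apply/mem_vertex_of.
  exists (d / c); first by rewrite mulf_neq0 ?invr_eq0.
  by rewrite eqd ?divfK // mulf_neq0 ?invr_eq0.
by exists (d * c); [exact: mulf_neq0|rewrite eqd].
Qed.

Lemma vertex_of_mulGLO A M : A \in unitmx -> homothetic_GLO v M -> vertex_of (A *m M) = vertex_of A.
Proof.
move=> uA hM; apply/esym/vertex_of_eq => //; last by rewrite mulKmx.
by rewrite unitmx_mul uA; exact: homothetic_GLO_unit hM.
Qed.

Lemma GLO_homothetic U : GLO v U -> homothetic_GLO v U.
Proof. by move=> gU; exists 1, U; rewrite oner_neq0 scale1r. Qed.

Lemma vertex_of_scale c A : c != 0 -> A \in unitmx -> vertex_of (c *: A) = vertex_of A.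
Proof.
move=> c0 uA; rewrite -[A in LHS]mulmx1 scalemxAr vertex_of_mulGLO //.
by exists c, 1%:M; split=> //; exact: GLO1.
Qed.

Lemma bt_vertP x : verts (bt_tree v) x <-> exists2 P, P \in unitmx & x = vertex_of P.
Proof.
split=> [[L [P uP ->] <-]|[P uP ->]]; first by exists P.
by exists (lattice_of v P) => //; exists P.
Qed.

Lemma valuation_piX (n : int) : v (pi ^ n) = n.
Proof.
have nat_case (m : nat) : v (pi ^+ m) = m%:Z.
  elim: m => [|m IH]; first by rewrite expr0 valuation1.
  by rewrite exprS (valuationM hv) ?expf_neq0 // IH vpi; lia.
case: n => m; first exact: nat_case.
rewrite NegzE -invr_expz valuationV ?expfz_neq0 // (_ : pi ^ _ = pi ^+ m.+1) //.
by rewrite nat_case.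
Qed.

Lemma piX0 (n : int) : pi ^ n != 0.
Proof. exact: expfz_neq0. Qed.

Lemma lattice_submodule P : is_submodule v (lattice_of v P).
Proof.
split.
- by exists 0; [move=> i; rewrite /integer_ring /= mxE val_ge0|rewrite mulmx0].
- move=> _ _ [a ai <-] [b bi <-]; exists (a + b); last by rewrite mulmxDr.
  by move=> i; rewrite /integer_ring /= mxE; apply: val_geD => //; [exact: ai|exact: bi].
- move=> c _ ci [a ai <-]; exists (c *: a); last by rewrite -scalemxAr.
  move=> i; rewrite /integer_ring /= mxE -[0]addr0; apply: val_geM => //; exact: ai.
Qed.

(** Right multiplication by this matrix leads to a neighbour of a vertex, and to any
    neighbour for a suitable basis of the lattice. *)
Definition stepmx : 'M[k]_2 := mat2 1 0 0 pi.

Lemma step_unit : stepmx \in unitmx.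
Proof. by rewrite unitmx_det det_mat2 mul1r mulr0 subr0. Qed.

(** A submodule of the larger lattice that is not contained in the smaller one has an
    element whose second coordinate is a unit, and with the first basis vector this
    element spans everything. *)
Lemma colength_one_step P : P \in unitmx ->
  colength_one v (lattice_of v (P *m stepmx)) (lattice_of v P).
Proof.
move=> uP; have iS : mx_ge v 0 stepmx.
  by apply/mx_ge_mat2; rewrite ?val_ge0 ?val_geE ?oner_neq0 ?valuation1 ?vpi.
split; first exact: lattice_mul_sub.
  move/esym/lattice_eq; rewrite unitmx_mul uP step_unit => /(_ isT isT).
  by rewrite mulKmx // => /(GLO_det hv); rewrite det_mat2 mul1r mulr0 subr0 vpi.
move=> M [M0 MD MZ] sM Ms.
have sP x y : val_ge v 0 x -> val_ge v 1 y -> M (P *m col2 x y).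
  move=> ix iy; apply: sM; exists (col2 x (y / pi)).
    elim/ord2P; rewrite /integer_ring /= mxE //=.
    by rewrite mulrC val_ge_mull ?invr_eq0 // valuationV // vpi opprK add0r.
  rewrite -mulmxA mul_mat2_col2 !mul1r !mul0r addr0 add0r.
  by rewrite mulrC divfK.
have [[x [y [My ix uy]]]|nu] := pselect (exists x y,
  [/\ M (P *m col2 x y), val_ge v 0 x & y != 0 /\ v y = 0]).
  right; apply/seteqP; split=> // _ [w wi <-]; rewrite (col2_eta w).
  have [y0 vy] := uy; pose a := w 1 0 / y.
  have ia : val_ge v 0 a.
    rewrite /a mulrC val_ge_mull ?invr_eq0 // valuationV // vy oppr0 subr0.
    exact: wi.
  have -> : col2 (w 0 0) (w 1 0) = a *: col2 x y + col2 (w 0 0 - a * x) 0.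
    apply/matrixP; elim/ord2P => j; rewrite !mxE /=.
      by rewrite addrC subrK.
    by rewrite addr0 /a divfK.
  rewrite mulmxDr -scalemxAr; apply: MD; first exact: MZ.
  apply: sP; last exact: val_ge0.
  apply: val_geB => //; first exact: wi.
  by rewrite -[0]addr0; exact: val_geM.
left; apply/seteqP; split=> // u Mu; have [w wi eu] := Ms _ Mu.
exists (col2 (w 0 0) (w 1 0 / pi)).
  have iw : val_ge v 1 (w 1 0).
    rewrite /val_ge; case: eqP => //= /eqP w0; rewrite leNgt; apply/negP => lt1.
    apply: nu; exists (w 0 0), (w 1 0); split; [by rewrite -col2_eta eu|exact: wi|].
    split=> //; have := wi 1; rewrite /integer_ring /= val_geE // => ge0.
    by apply: le_anti; rewrite ge0 andbT -ltzD1.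
  elim/ord2P; rewrite /integer_ring /= mxE //=; first exact: wi.
  by rewrite mulrC val_ge_mull ?invr_eq0 // valuationV // vpi opprK add0r.
rewrite -mulmxA mul_mat2_col2 !mul1r !mul0r addr0 add0r.
by rewrite mulrC divfK // -col2_eta.
Qed.

Lemma adjacent_step P : P \in unitmx -> adjacent v (vertex_of P) (vertex_of (P *m stepmx)).
Proof.
move=> uP; exists (lattice_of v P), (lattice_of v (P *m stepmx)); split.
- by apply/mem_vertex_of; exists 1; rewrite ?oner_neq0 ?scale1r.
- by apply/mem_vertex_of; exists 1; rewrite ?oner_neq0 ?scale1r.
exact: colength_one_step.
Qed.

(** The column whose second entry has the smaller valuation serves as the pivot. *)
Lemma hermite A : A \in unitmx -> exists (i j : int) (b : k) (U : 'M[k]_2),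
  GLO v U /\ A *m U = mat2 (pi ^ i) b 0 (pi ^ j).
Proof.
have main a b c d : d != 0 -> val_ge v (v d) c -> a * d - b * c != 0 ->
    exists (i j : int) (b' : k) (U : 'M[k]_2),
      GLO v U /\ mat2 a b c d *m U = mat2 (pi ^ i) b' 0 (pi ^ j).
  move=> d0 cd det0; pose a' := a - b * (c / d).
  have a'0 : a' != 0.
    apply: contra det0 => /eqP a'0; apply/eqP.
    have -> : a * d - b * c = a' * d by rewrite /a'; field.
    by rewrite a'0 mul0r.
  pose al := pi ^ (v a') / a'; pose be := pi ^ (v d) / d.
  have al0 : al != 0 by rewrite mulf_neq0 ?piX0 ?invr_eq0.
  have be0 : be != 0 by rewrite mulf_neq0 ?piX0 ?invr_eq0.
  have val : v al = 0.
    by rewrite (valuationM hv) ?piX0 ?invr_eq0 // valuation_piX valuationV // subrr.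
  have vbe : v be = 0.
    by rewrite (valuationM hv) ?piX0 ?invr_eq0 // valuation_piX valuationV // subrr.
  exists (v a'), (v d), (b * be), (mat2 al 0 (- (c / d) * al) be); split.
    apply: GLO_mat2; rewrite ?mul0r ?subr0 ?val_ge0 //.
    - by rewrite val_geE // val.
    - rewrite mulrC val_ge_mull // val subr0 val_geN // mulrC.
      by rewrite val_ge_mull ?invr_eq0 // valuationV // opprK add0r.
    - by rewrite val_geE // vbe.
    - exact: mulf_neq0.
    by rewrite (valuationM hv) // val vbe.
  rewrite mul_mat2; congr mat2; rewrite ?mulr0 ?add0r //.
  - by rewrite -[RHS](divfK a'0) -/al /a'; ring.
  - by field.
  - by rewrite /be mulrC divfK.
move=> uA; rewrite (mat2_eta A) in uA *; move: uA.
move: (A 0 0) (A 0 1) (A 1 0) (A 1 1) => {A} a b c d.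
rewrite unitmx_det det_mat2 => det0.
have swap : GLO v (mat2 0 1 1 0).
  apply: GLO_mat2; rewrite ?val_ge0 ?val_geE ?oner_neq0 ?valuation1 //.
    by rewrite mul0r mul1r sub0r oppr_eq0 oner_neq0.
  by rewrite mul0r mul1r sub0r valuationN ?oner_neq0 // valuation1.
have [[d0 cd]|nd] := pselect (d != 0 /\ val_ge v (v d) c); first exact: main.
have [i [j [b' [U [gU eU]]]]] : exists (i j : int) (b' : k) (U : 'M[k]_2),
    GLO v U /\ mat2 b a d c *m U = mat2 (pi ^ i) b' 0 (pi ^ j).
  have det0' : b * c - a * d != 0 by rewrite -opprB oppr_eq0.
  have c0 : c != 0.
    apply/negP => /eqP c0; apply: nd; rewrite c0 val_ge0; split=> //.
    by apply: contra det0 => /eqP ->; rewrite c0 !mulr0 subr0.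
  apply: main => //; have [->|d0] := eqVneq d 0; first exact: val_ge0.
  rewrite val_geE //; have [//|lt] := leP (v c) (v d).
  by case: nd; split=> //; rewrite val_geE // ltW.
exists i, j, b', (mat2 0 1 1 0 *m U); split; first exact: GLO_mul.
by rewrite mulmxA mul_mat2 !mulr0 !mulr1 !add0r !addr0.
Qed.

(** When the determinant of a column reduced matrix has valuation at least 2, the
    matrix factors through an intermediate lattice; so colength one leaves only two
    shapes. *)
Lemma adjacent_cases P y : P \in unitmx -> verts (bt_tree v) y ->
  adjacent v (vertex_of P) y ->
  y = vertex_of (P *m stepmx) \/
  exists2 b, val_ge v 0 b & y = vertex_of (P *m mat2 pi b 0 1).
Proof.
have eq1 (a : int) : a - 1 = 0 -> a = 1 by lia.
have ge1 (a : int) : 0 <= a -> a != 0 -> 0 <= a - 1 by lia.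
have eq0 (a b : int) : 0 <= a -> a != 0 -> 0 <= b -> a - 1 + b = 0 -> b = 0 by lia.
move=> uP /bt_vertP[Q uQ ->] [_ [_ [/mem_vertex_of[c c0 ->] /mem_vertex_of[d d0 ->]]]].
have uc : c *: P \in unitmx by rewrite unitmxZ ?unitfE.
have ud : d *: Q \in unitmx by rewrite unitmxZ ?unitfE.
rewrite -(vertex_of_scale d0 uQ); have uA : invmx (c *: P) *m (d *: Q) \in unitmx.
  by rewrite unitmx_mul unitmx_inv uc.
have [i [j [b [U [gU eU]]]]] := hermite uA.
set T := mat2 _ _ _ _ in eU.
have detT : \det T = pi ^ i * pi ^ j by rewrite det_mat2 mulr0 subr0.
have uT : T \in unitmx by rewrite unitmx_det detT mulf_neq0 ?piX0.
have -> : lattice_of v (d *: Q) = lattice_of v (c *: P *m T).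
  by rewrite -eU !mulmxA mulmxV // mul1mx lattice_GLO.
have -> : vertex_of (d *: Q) = vertex_of (P *m T).
  rewrite -(vertex_of_scale c0 (A := P *m T)) ?unitmx_mul ?uP //.
  rewrite -eU scalemxAl !mulmxA mulmxV // mul1mx vertex_of_mulGLO //.
  exact: GLO_homothetic.
case=> sT nT midT.
have mid T' S : T' \in unitmx -> S \in unitmx -> mx_ge v 0 T' -> mx_ge v 0 S ->
    v (\det S) <> 0 -> lattice_of v (c *: P *m T) = lattice_of v (c *: P *m (T' *m S)) ->
    v (\det T') = 0.
  move=> uT' uS iT' iS vS eT.
  have [||/esym e|e] := midT _ (lattice_submodule (c *: P *m T')).
  - by rewrite eT mulmxA; apply: lattice_mul_sub => //; rewrite unitmx_mul uc.
  - exact: lattice_mul_sub.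
  - case: vS; apply: GLO_det => //.
    move: e; rewrite eT mulmxA => /esym/lattice_eq.
    by rewrite mulKmx ?unitmx_mul ?uc ?uT' ?uS // => /(_ isT isT).
  - apply: GLO_det => //; move/esym/lattice_eq: e.
    by rewrite mulKmx ?unitmx_mul ?uc ?uT' // => /(_ isT isT).
have /mx_ge_mat2[] : mx_ge v 0 T.
  by move/lattice_sub: sT; rewrite mulKmx //; apply.
move=> i0 ib _ j0; rewrite (val_geE _ _ (piX0 _)) valuation_piX in i0.
rewrite (val_geE _ _ (piX0 _)) valuation_piX in j0.
have ui : val_ge v 0 1 by rewrite val_geE ?oner_neq0 // valuation1.
have ipi n : 0 <= n -> val_ge v 0 (pi ^ n) by rewrite val_geE ?piX0 // valuation_piX.
have ipi1 : val_ge v 0 pi by rewrite val_geE // vpi.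
have piS n : pi ^ n = pi ^ (n - 1) * pi by rewrite -{3}[pi]expr1z -expfzDr // subrK.
have [i00|i00] := eqVneq i 0.
  left; have gU' : GLO v (mat2 1 (- b) 0 1).
    apply: GLO_mat2; rewrite ?val_ge0 ?val_geN //;
    by rewrite mulr1 mulr0 subr0 ?oner_neq0 ?valuation1.
  have eT : T *m mat2 1 (- b) 0 1 = mat2 1 0 0 (pi ^ j).
    by rewrite mul_mat2 i00 expr0z; congr mat2; ring.
  have j1 : j = 1.
    have [j00|j00] := eqVneq j 0.
      case: nT; rewrite -[RHS](lattice_GLO (U := T)) //.
      by apply: GLO_of_det => //; [apply/mx_ge_mat2; rewrite i00 j00 expr0z val_ge0|
         rewrite detT (valuationM hv) ?piX0 // !valuation_piX i00 j00].
    have := mid (mat2 1 0 0 (pi ^ (j - 1))) stepmx.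
    rewrite !unitmx_det !det_mat2 !mul1r !mul0r !subr0 vpi valuation_piX.
    move=> /(_ (piX0 _) pi0) h; apply/eq1/h => //.
    - by apply/mx_ge_mat2; rewrite val_ge0 ipi ?ge1.
    - by apply/mx_ge_mat2; rewrite val_ge0.
    rewrite -(lattice_GLO _ gU') ?unitmx_mul ?uc // -mulmxA eT.
    by rewrite mul_mat2 !mul1r !mulr0 !mul0r !addr0 !add0r -piS.
  rewrite -(vertex_of_mulGLO (M := mat2 1 (- b) 0 1)) ?unitmx_mul ?uP //.
    by rewrite -mulmxA eT j1 expr1z.
  exact: GLO_homothetic.
right; exists b => //.
have ij : i - 1 + j = 0.
  have := mid (mat2 (pi ^ (i - 1)) b 0 (pi ^ j)) (mat2 pi 0 0 1).
  rewrite !unitmx_det !det_mat2 !mulr1 !mulr0 !subr0 vpi (valuationM hv) ?piX0 //.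
  rewrite !valuation_piX mulf_neq0 ?piX0 // => /(_ isT pi0); apply=> //.
  - by apply/mx_ge_mat2; rewrite val_ge0 !ipi ?ge1.
  - by apply/mx_ge_mat2; rewrite val_ge0.
  by rewrite mul_mat2 !mulr0 !mul0r !mulr1 !addr0 !add0r -piS.
have j00 := eq0 _ _ i0 i00 j0 ij; rewrite j00 addr0 in ij.
by rewrite /T (eq1 _ ij) j00 expr1z expr0z.
Qed.

End Lattices.

(** The vertices are the balls [a + pi ^ n O] of the field, and the edges join each
    ball to the smallest strictly larger one: directed to the end at infinity, the
    tree is a rooted forest. *)
Section BallModel.
Variables (k : fieldType) (v : k -> int).
Hypothesis hv : discrete_valuation v.
Variable pi : k.
Hypotheses (pi0 : pi != 0) (vpi : v pi = 1).
Local Notation vertex_of := (vertex_of v).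
Local Notation step := (stepmx pi).
Implicit Types (n m : int) (a b : k).

Definition ball n a : 'M[k]_2 := mat2 (pi ^ n) a 0 1.

Lemma ball_unit n a : ball n a \in unitmx.
Proof. by rewrite unitmx_det det_mat2 mulr1 mulr0 subr0 piX0. Qed.

Lemma bt_ball x : verts (bt_tree v) x -> exists n a, x = vertex_of (ball n a).
Proof.
move=> /bt_vertP[P uP ->]; have [i [j [b [U [gU eU]]]]] := hermite hv pi0 vpi uP.
exists (i - j), (b * pi ^ (- j)).
rewrite -(vertex_of_mulGLO hv uP (GLO_homothetic gU)) eU.
rewrite -(vertex_of_scale hv (piX0 pi0 j) (ball_unit _ _)) scale_mat2 mulr0 mulr1.
by rewrite -expfzDr // addrC subrK mulrC -mulrA -expfzDr // addNr expr0z mulr1.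
Qed.

Lemma bt_vertex_of P : P \in unitmx -> verts (bt_tree v) (vertex_of P).
Proof. by move=> uP; apply/bt_vertP; exists P. Qed.

Lemma ball_mul n a m b : ball n a *m mat2 (pi ^ m) b 0 1 = ball (n + m) (pi ^ n * b + a).
Proof. by rewrite /ball mul_mat2 !mulr0 !mul0r !mulr1 !addr0 add0r expfzDr. Qed.

Lemma ball_eq n a m b : vertex_of (ball n a) = vertex_of (ball m b) ->
  n = m /\ val_ge v n (b - a).
Proof.
have -> : ball m b = ball n a *m mat2 (pi ^ (m - n)) ((b - a) / pi ^ n) 0 1.
  rewrite ball_mul addrC subrK; congr ball.
  by rewrite mulrC divfK ?piX0 // subrK.
set M := mat2 _ _ _ _; have uM : M \in unitmx.
  by rewrite unitmx_det det_mat2 mulr1 mulr0 subr0 piX0.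
have uB : ball n a *m M \in unitmx by rewrite unitmx_mul ball_unit.
move/(vertex_of_eq hv (ball_unit n a) uB); rewrite mulKmx ?ball_unit // => -[c [U [c0 gU eM]]].
have [iU uU _] := gU; have c10 : c^-1 != 0 by rewrite invr_eq0.
have eU : U = c^-1 *: M by rewrite eM scalerA mulVf // scale1r.
have /mx_ge_mat2[] : mx_ge v 0 (mat2 (c^-1 * pi ^ (m - n)) (c^-1 * ((b - a) / pi ^ n))
    (c^-1 * 0) (c^-1 * 1)) by rewrite -scale_mat2 -eU.
rewrite (val_ge_mull hv _ _ c10) (val_geE _ _ (piX0 pi0 _)) valuation_piX // valuationV //.
rewrite (val_ge_mull hv _ _ c10) valuationV //.
rewrite mulr1 (val_geE _ _ c10) valuationV // => i00 i01 _ i11.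
have := GLO_det hv gU; rewrite eU detZ (valuationM hv) ?expf_neq0 //; last first.
  by rewrite -unitmx_det.
rewrite expr2 (valuationM hv) // valuationV // det_mat2 mulr1 mulr0 subr0 valuation_piX // => eqv.
have {i00 i11 eqv} [vc nm] : v c = 0 /\ n = m by clear -i00 i11 eqv; lia.
split=> //; move: i01; rewrite vc !oppr0 subr0 mulrC val_ge_mull ?invr_eq0 ?piX0 //.
by rewrite valuationV ?piX0 // valuation_piX // opprK add0r.
Qed.

Lemma ball_eq_of n a b : val_ge v n (b - a) -> vertex_of (ball n a) = vertex_of (ball n b).
Proof.
move=> nab; rewrite -(vertex_of_mulGLO hv (ball_unit n a) (M := mat2 1 ((b - a) / pi ^ n) 0 1)).
  by rewrite -[mat2 1 _ _ _](congr1 (fun x => mat2 x _ 0 1) (expr0z pi)) ball_mul addr0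
     mulrC divfK ?piX0 // subrK.
apply: GLO_homothetic; apply: GLO_mat2;
  rewrite ?mulr1 ?mulr0 ?subr0 ?val_ge0 ?oner_neq0 ?valuation1 //;
  rewrite ?(val_geE _ _ (oner_neq0 k)) ?valuation1 //.
by rewrite mulrC val_ge_mull ?invr_eq0 ?piX0 // valuationV ?piX0 // valuation_piX // opprK add0r.
Qed.

Definition parent (x y : vertex k) : Prop :=
  exists n a, x = vertex_of (ball n a) /\ y = vertex_of (ball (n - 1) a).

Lemma parent_fun x y z : parent x y -> parent x z -> y = z.
Proof.
move=> [n [a [-> ->]]] [m [b [/ball_eq[<- nab] ->]]].
by apply: ball_eq_of; apply: val_geW nab; rewrite gerBl.
Qed.

Lemma vertex_of_ball_step n a : vertex_of (ball n a *m step) = vertex_of (ball (n - 1) a).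
Proof.
have piE : pi * pi ^ (n - 1) = pi ^ n.
  by rewrite -[X in X * _]expr1z -expfzDr // addrC subrK.
rewrite -(vertex_of_scale hv pi0 (ball_unit (n - 1) a)); congr similarity_class.
congr lattice_of; rewrite mul_mat2 scale_mat2 !mulr0 !mulr1 !mul1r !addr0 !add0r.
by rewrite piE (mulrC a).
Qed.

Lemma swap_GLO : GLO v (mat2 0 1 1 0).
Proof.
have v10 : val_ge v 0 1 by rewrite val_geE ?oner_neq0 // valuation1.
apply: GLO_mat2; rewrite ?val_ge0 // mul0r mul1r sub0r ?oppr_eq0 ?oner_neq0 //.
by rewrite valuationN ?oner_neq0 // valuation1.
Qed.

(** The smaller lattice contains the multiple by [pi] of the larger one, with colength
    one. *)
Lemma adjacent_step_sym P : P \in unitmx -> adjacent v (vertex_of (P *m step)) (vertex_of P).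
Proof.
move=> uP; have gs := GLO_homothetic swap_GLO.
have us : P *m step \in unitmx by rewrite unitmx_mul uP step_unit.
have -> : vertex_of P = vertex_of ((P *m step) *m mat2 0 1 1 0 *m step).
  rewrite -(vertex_of_mulGLO hv uP gs).
  rewrite -(vertex_of_scale hv pi0 (A := P *m mat2 0 1 1 0)); last first.
    by rewrite unitmx_mul uP; case: swap_GLO.
  congr similarity_class; congr lattice_of.
  rewrite -!mulmxA !mul_mat2 scalemxAr scale_mat2; congr (_ *m mat2 _ _ _ _); ring.
rewrite -(vertex_of_mulGLO hv us gs); apply: adjacent_step => //.
by rewrite unitmx_mul us; case: swap_GLO.
Qed.

Lemma adjacent_parent x y : verts (bt_tree v) x -> verts (bt_tree v) y ->
  adjacent v x y <-> parent x y \/ parent y x.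
Proof.
move=> /bt_ball[n [a ->]] vy; split.
  move=> /(adjacent_cases hv pi0 vpi (ball_unit n a) vy)[->|[b ib ->]].
    by left; exists n, a; rewrite vertex_of_ball_step.
  right; exists (n + 1), (pi ^ n * b + a); rewrite -ball_mul expr1z; split=> //.
  rewrite addrK; apply: ball_eq_of; rewrite addrK -[X in val_ge _ X]addr0.
  apply: val_geM => //.
  by rewrite (val_geE _ _ (piX0 pi0 _)) valuation_piX.
case=> -[m [b [-> ->]]]; rewrite -vertex_of_ball_step.
  by apply: adjacent_step => //; exact: ball_unit.
by apply: adjacent_step_sym; exact: ball_unit.
Qed.

Lemma bt_serre : serre_graph (bt_tree v).
Proof.
move=> [x y] [/= vx vy xy]; split=> //=; split=> //=.
by apply/adjacent_parent => //; apply/or_comm/adjacent_parent.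
Qed.

(** The level of a ball is the exponent [n] of its radius. *)
Lemma bt_acyclic : acyclic (bt_tree v).
Proof.
have levP x : exists n, verts (bt_tree v) x -> exists a, x = vertex_of (ball n a).
  have [/bt_ball[n [a ->]]|nx] := pselect (verts (bt_tree v) x); last by exists 0.
  by exists n; exists a.
have [lev {}levP] := choice levP.
apply: (rooted_acyclic (par := parent) (lev := lev) bt_serre).
- by move=> [x y] [x' y'] _ _ /= -> ->.
- by move=> e [vs vt a12]; apply/adjacent_parent.
- by move=> x y z _; exact: parent_fun.
move=> x y vx [n [a [ex ey]]]; have [b] := levP x vx; rewrite {1}ex => /ball_eq[<- _].
have vy : verts (bt_tree v) y by rewrite ey; apply/bt_vertex_of/ball_unit.
have [c] := levP y vy; rewrite {1}ey => /ball_eq[<- _]; by rewrite subrK.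
Qed.

Lemma bt_climb (m : nat) n a : exists p,
  walk (bt_tree v) (vertex_of (ball n a)) p (vertex_of (ball (n - m%:Z) a)).
Proof.
elim: m n => [|m IH] n.
  by exists [::]; rewrite subr0; split=> //; apply/bt_vertex_of/ball_unit.
have [p wp] := IH (n - 1).
have b1 := bt_vertex_of (ball_unit n a); have b2 := bt_vertex_of (ball_unit (n - 1) a).
exists ((vertex_of (ball n a), vertex_of (ball (n - 1) a)) :: p); split=> //=.
  by split=> //; apply/adjacent_parent => //; left; exists n, a.
suff <- : n - 1 - m%:Z = n - m.+1%:Z by [].
by clear; lia.
Qed.

(** Two balls are contained in a common larger one. *)
Lemma bt_connected : connected (bt_tree v).
Proof.
move=> _ _ /bt_ball[n [a ->]] /bt_ball[m [b ->]].
have [l nab] : exists l : nat, val_ge v (n - l%:Z) (b - a).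
  by exists (absz (n - v (b - a))); rewrite /val_ge; case: eqP => //= _; clear; lia.
have [s [t [st sl]]] : exists s t : nat, n - s%:Z = m - t%:Z /\ n - s%:Z <= n - l%:Z.
  pose s := addn l (absz (m - n)); exists s, (absz (m - (n - s%:Z))%R).
  by rewrite /s; clear; lia.
have [p wp] := bt_climb s n a; have [q wq] := bt_climb t m b.
exists (p ++ back (bt_tree v) q); apply: walk_cat wp _.
rewrite (ball_eq_of (b := b)); last exact: val_geW nab.
by rewrite st; apply: walk_back => //; exact: bt_serre.
Qed.

End BallModel.

(** * Finiteness of the stabilizers *)

Section ProjectiveGroup.
Variable k : fieldType.
Implicit Types (x y z : PGL2 k) (P A B M : 'M[k]_2) (u w : 'cV[k]_2).

Lemma matrix_of_unit x : matrix_of x \in unitmx.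
Proof. exact: (valP (repr x)). Qed.

Lemma matrix_ofM x y :
  exists2 c : k, c != 0 & matrix_of (x * y)%g = c *: (matrix_of x *m matrix_of y).
Proof. exact: (repr_piP (GL2_mul (repr x) (repr y))). Qed.

Lemma matrix_of_inj x y c : c != 0 -> matrix_of x = c *: matrix_of y -> x = y.
Proof. by move=> c0 e; rewrite -[x]reprK -[y]reprK; exact: PGL2_eq c0 e. Qed.

(** [M] is, up to homothety, the matrix of [x] in the basis formed by the columns
    of [P]. *)
Definition in_basis P x M : Prop :=
  exists2 c : k, c != 0 & M = c *: (invmx P *m matrix_of x *m P).

Lemma in_basis_self P x : in_basis P x (invmx P *m matrix_of x *m P).
Proof. by exists 1; rewrite ?oner_neq0 ?scale1r. Qed.

Lemma in_basis_scale P x M c : c != 0 -> in_basis P x M -> in_basis P x (c *: M).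
Proof. by move=> c0 [d d0 ->]; exists (c * d); rewrite ?mulf_neq0 ?scalerA. Qed.

Section Basis.
Variable P : 'M[k]_2.
Hypothesis uP : P \in unitmx.

Lemma in_basis_unit x M : in_basis P x M -> M \in unitmx.
Proof.
case=> c c0 ->; rewrite unitmxZ ?unitfE // !unitmx_mul unitmx_inv uP.
by rewrite matrix_of_unit.
Qed.

Lemma in_basis_matrix x M : in_basis P x M ->
  exists2 c : k, c != 0 & matrix_of x *m P = c *: (P *m M).
Proof.
case=> c c0 ->; exists c^-1; rewrite ?invr_eq0 // -scalemxAr scalerA mulVf //.
by rewrite scale1r !mulmxA mulmxV // mul1mx.
Qed.

Lemma in_basisM x y M M' : in_basis P x M -> in_basis P y M' ->
  in_basis P (x * y)%g (M *m M').
Proof.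
move=> [c c0 ->] [d d0 ->]; have [e e0 exy] := matrix_ofM x y.
exists (c * d / e); first by rewrite !mulf_neq0 ?invr_eq0.
have -> : invmx P *m matrix_of (x * y)%g *m P =
    e *: ((invmx P *m matrix_of x *m P) *m (invmx P *m matrix_of y *m P)).
  by rewrite exy -scalemxAr -scalemxAl !mulmxA mulmxK.
by rewrite -scalemxAl -scalemxAr !scalerA divfK.
Qed.

Lemma in_basis_inj x y M : in_basis P x M -> in_basis P y M -> x = y.
Proof.
move=> /in_basis_matrix[c c0 ex] /in_basis_matrix[d d0 ey].
apply: (@matrix_of_inj _ _ (c / d)); first by rewrite mulf_neq0 ?invr_eq0.
apply: (can_inj (mulmxK uP)); rewrite -scalemxAl ey scalerA divfK //.
Qed.

Lemma in_basis1 : in_basis P 1%g 1%:M.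
Proof.
have := in_basis_self P 1%g; set M := _ *m P => hM.
have uM := in_basis_unit hM; have := in_basisM hM hM; rewrite mulg1 => -[c c0 eM].
exists c^-1; rewrite ?invr_eq0 //; apply: (can_inj (mulKmx uM)).
by rewrite mulmx1 -scalemxAr eM scalerA mulVf // scale1r.
Qed.

Lemma in_basisV x M : in_basis P x M -> in_basis P x^-1%g (invmx M).
Proof.
move=> hM; have uM := in_basis_unit hM.
have [c c0 eM] := in_basisM hM (in_basis_self P x^-1%g).
rewrite mulgV in eM; have [d d0 e1] := in_basis1.
exists (d / c); first by rewrite mulf_neq0 ?invr_eq0.
apply: (can_inj (mulKmx uM)); rewrite mulmxV // -scalemxAr eM scalerA divfK //.
Qed.

End Basis.
End ProjectiveGroup.

Section Orbits.
Variables (k : fieldType) (v : k -> int).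
Hypothesis hv : discrete_valuation v.
Implicit Types (x y z : PGL2 k) (P A B M : 'M[k]_2) (u w : 'cV[k]_2).

Lemma line_scale c u : c != 0 -> line (c *: u) = line u.
Proof.
move=> c0; apply/seteqP; split=> _ [d _ <-].
  by exists (d * c); rewrite ?scalerA.
by exists (d / c); rewrite // scalerA divfK.
Qed.

Lemma line_eq u w : w != 0 -> line u = line w -> exists2 c : k, c != 0 & w = c *: u.
Proof.
move=> w0 e; have [c _ ec] : line u w by rewrite e; exists 1; rewrite ?scale1r.
exists c => //; apply: contra w0 => /eqP c0.
by rewrite -ec c0 scale0r.
Qed.

Lemma act_line x u : act_set x (line u) = line (matrix_of x *m u).
Proof.
apply/seteqP; split=> [_ [_ [c _ <-] <-]|_ [c _ <-]].
  by exists c; rewrite // scalemxAr.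
by exists (c *: u); [exists c|rewrite scalemxAr].
Qed.

Lemma act_line_basis P x M u : P \in unitmx -> in_basis P x M ->
  act_set x (line (P *m u)) = line (P *m (M *m u)).
Proof.
move=> uP /(in_basis_matrix uP)[c c0 e].
by rewrite act_line mulmxA e -scalemxAl line_scale // mulmxA.
Qed.

Lemma mulmx_neq0 A u : A \in unitmx -> u != 0 -> A *m u != 0.
Proof.
move=> uA; apply: contra => /eqP e.
by rewrite -(mulKmx uA u) e mulmx0.
Qed.

Lemma act_P1 x l : P1 l -> P1 (act_set x l).
Proof.
case=> u u0 <-; rewrite act_line; exists (matrix_of x *m u) => //=.
by apply: mulmx_neq0 => //; exact: matrix_of_unit.
Qed.

Lemma converges_mx (u : nat -> 'cV[k]_2) w :
  (forall j, converges v (fun i => u i j 0) (w j 0)) <->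
  forall n, exists m, forall i, (m <= i)%N -> mx_ge v n (u i - w).
Proof.
split=> [h n|h j n].
  have [[m0 h0] [m1 h1]] := (h 0 n, h 1 n).
  exists (maxn m0 m1) => i; rewrite geq_max => /andP[l0 l1].
  elim/ord2P => j; rewrite ord1 !mxE; [exact: h0|exact: h1].
by have [m hm] := h n; exists m => i /hm /(_ j 0); rewrite !mxE.
Qed.

Lemma converges_mulmx A (u : nat -> 'cV[k]_2) w :
  (forall j, converges v (fun i => u i j 0) (w j 0)) ->
  forall j, converges v (fun i => (A *m u i) j 0) ((A *m w) j 0).
Proof.
move=> /converges_mx h; apply/converges_mx => n.
have [b bA] := mx_ge_bound v A; have [m hm] := h (n - b).
exists m => i /hm ge; rewrite -mulmxBr -[n](subrK b) addrC.
exact: mx_geM.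
Qed.

(** For matrices determined up to scalars only, this replaces the Cauchy property of
    the images of [u]. *)
Definition close_images (M : nat -> 'M[k]_2) u : Prop :=
  forall n, exists m, forall i j, (m <= i)%N -> (m <= j)%N ->
    exists c, mx_ge v n (M i *m u - c *: (M j *m u)).

Lemma close_images_sub (M : nat -> 'M[k]_2) u (phi : nat -> nat) : {homo phi : i j / (i < j)%N} ->
  close_images M u -> close_images (M \o phi) u.
Proof.
move=> hphi h n; have [m hm] := h n.
have ge i : (i <= phi i)%N.
  by elim: i => [//|i IH]; exact: leq_ltn_trans IH (hphi _ _ (ltnSn i)).
by exists m => i j li lj; apply: hm; [exact: leq_trans li (ge i)|exact: leq_trans lj (ge j)].
Qed.

(** Vectors spanning the image lines can be chosen convergent, with a non-zero limit.
    The factors relating them to the images under the bounded matrices are then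
    bounded, so that the differences of these images remain small. *)
Lemma converging_lines_close P (g : nat -> PGL2 k) (M : nat -> 'M[k]_2) b u l :
  P \in unitmx -> (forall i, in_basis P (g i) (M i)) -> (forall i, mx_ge v b (M i)) ->
  mx_ge v 0 u -> P1_converges v (fun i => act_set (g i) (line (P *m u))) l ->
  close_images M u.
Proof.
move=> uP gM bM iu [y [w [yP [w0 _] yw]]] n.
have tauP i : exists t, t != 0 /\ M i *m u = t *: (invmx P *m y i).
  have [yi0 e] := yP i; rewrite (act_line_basis u uP (gM i)) in e.
  have [c c0 ec] := line_eq yi0 e; exists c^-1; rewrite invr_eq0; split=> //.
  by rewrite ec -scalemxAr scalerA mulVf // scale1r mulKmx.
have [t {}tauP] := choice tauP.
pose x i := invmx P *m y i; pose x0 := invmx P *m w.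
have xx0 := (converges_mx x x0).1 (converges_mulmx (invmx P) yw).
have [j xj0] : exists j, x0 j 0 != 0.
  have : x0 != 0 by apply: mulmx_neq0; rewrite ?unitmx_inv.
  have [z0|?] := eqVneq (x0 0 0) 0; last by exists 0.
  have [z1|?] := eqVneq (x0 1 0) 0; last by exists 1.
  case/negP; apply/eqP/matrixP; elim/ord2P => i; rewrite ord1 [RHS]mxE //.
have [m1 hm1] := xx0 (v (x0 j 0) + 1).
have [m2 hm2] := xx0 (n - (b - v (x0 j 0))).
have tb i : (m1 <= i)%N -> val_ge v (b - v (x0 j 0)) (t i).
  move=> /hm1 /(_ j 0); rewrite [X in val_ge _ _ X]mxE [(- x0) j 0]mxE => xi.
  have [ti0 eM] := tauP i.
  have bi : val_ge v b (t i * x i j 0).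
    have := mx_geM hv (bM i) iu j 0; rewrite addr0 eM mxE; apply: val_geW.
    by [].
  have nx : ~~ val_ge v (v (x0 j 0) + 1) (x i j 0).
    apply/negP => ge; have := val_geB hv ge xi; rewrite subKr.
    by rewrite val_geE // -ltzD1 ltxx.
  have xi0 : x i j 0 != 0 by apply: contra nx => /eqP ->; rewrite val_ge0.
  move: bi; rewrite mulrC val_ge_mull //; apply: val_geW; rewrite lerB //.
  by move: nx; rewrite val_geE // -ltNge ltzD1.
exists (maxn m1 m2) => i i'; rewrite !geq_max => /andP[i1 i2] /andP[i1' i2'].
exists (t i / t i'); have [ti0 ->] := tauP i; have [ti0' ->] := tauP i'.
rewrite scalerA divfK // -scalerBr -[n](subrK (b - v (x0 j 0))) addrC.
apply: mx_geZ => //; first exact: tb.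
have -> : invmx P *m y i - invmx P *m y i' = (x i - x0) - (x i' - x0).
  by rewrite opprB addrA subrK.
by apply: mx_geB => //; exact: hm2.
Qed.

(** A congruence neighbourhood of the identity. *)
Definition near1 P n x : Prop := exists E, mx_ge v n E /\ in_basis P x (1%:M + E).

Lemma near1W P m n x : m <= n -> near1 P n x -> near1 P m x.
Proof. by move=> mn [E [nE xE]]; exists E; split=> //; exact: mx_geW nE. Qed.

(** The entries outside the diagonal and the difference of the diagonal entries are,
    relatively to the first entry, of arbitrarily large valuation, hence zero. *)
Lemma near1_separated P x : P \in unitmx -> (forall n : nat, near1 P n%:Z x) -> x = 1%g.
Proof.
move=> uP h; set M := invmx P *m matrix_of x *m P.
have hM (n : nat) : exists c E, [/\ c != 0, M = c *: (1%:M + E) & mx_ge v n%:Z E].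
  have [E [nE [c c0 e]]] := h n; exists c^-1, E; rewrite invr_eq0; split=> //.
  by rewrite e scalerA mulVf // scale1r.
pose q := M 0 0.
have eM (n : nat) : 1 <= n%:Z -> exists E,
    [/\ mx_ge v n%:Z E, v (1 + E 0 0) = 0, q != 0, 1 + E 0 0 != 0 &
     M = (q / (1 + E 0 0)) *: (1%:M + E)].
  move=> n1; have [c [E [c0 e nE]]] := hM n; exists E.
  have E0 : 1 + E 0 0 != 0.
    apply/negP => /eqP z; have := nE 0 0.
    have -> : E 0 0 = -1 by apply/eqP; rewrite -addr_eq0 addrC z.
    by rewrite val_geN // val_geE ?oner_neq0 // valuation1 //; clear -n1; lia.
  have eq : q = c * (1 + E 0 0) by rewrite /q e !mxE.
  split=> //.
  - have i1 : val_ge v 0 (1 + E 0 0).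
      apply: val_geD => //; first by rewrite val_geE ?oner_neq0 // valuation1.
      by apply: val_geW (nE 0 0); clear -n1; lia.
    have n1' : ~~ val_ge v 1 (1 + E 0 0).
      apply/negP => ge; have := val_geB hv ge (val_geW n1 (nE 0 0)).
      by rewrite addrK val_geE ?oner_neq0 // valuation1.
    rewrite !val_geE // -ltNge in i1 n1' *.
    by apply: le_anti; rewrite i1 andbT -ltzD1.
  - by rewrite eq mulf_neq0.
  - by rewrite eq mulfK.
(* A linear form vanishing at the identity is small at [M] compared with [q]. *)
have small (f : 'M[k]_2 -> k) : (forall n E, mx_ge v n E -> val_ge v n (f E)) ->
    (forall c E, f (c *: (1%:M + E)) = c * f E) -> f M = 0.
  move=> fge fZ; apply: (val_ge_eq0 (v := v)) => n.
  have [E [nE E0 q0 E1 e]] := eM (n + absz (v q)).+1 isT.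
  rewrite e fZ; have [->|cz] := eqVneq (f E) 0; first by rewrite mulr0 val_ge0.
  rewrite val_ge_mull // ?mulf_neq0 ?invr_eq0 //.
  rewrite (valuationM hv) ?invr_eq0 // valuationV // E0; apply: val_geW (fge _ _ nE).
  by clear; lia.
have M01 : M 0 1 = 0.
  apply: (small (fun M => M 0 1)) => [n E|c E]; first exact.
  by rewrite !mxE add0r.
have M10 : M 1 0 = 0.
  apply: (small (fun M => M 1 0)) => [n E|c E]; first exact.
  by rewrite !mxE add0r.
have M11 : M 1 1 = M 0 0.
  apply/eqP; rewrite -subr_eq0; apply/eqP.
  apply: (small (fun M => M 1 1 - M 0 0)) => [n E nE|c E]; first exact: val_geB.
  by rewrite !mxE /=; ring.
have [E [_ _ q0 _ _]] := eM 1%N isT.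
apply: (@in_basis_inj _ P uP _ _ 1%:M); last exact: in_basis1.
exists q^-1; first by rewrite invr_eq0.
rewrite -/M [M]mat2_eta M01 M10 M11 scale_mat2 !mulr0 mulVf // mat2_1 //.
Qed.

Lemma near1_converges P (a : nat -> PGL2 k) l : P \in unitmx -> P1 l ->
  (forall i, near1 P i%:Z (a i)) -> P1_converges v (fun i => act_set (a i) l) l.
Proof.
move=> uP [w w0 <-] ha; have [E hE] := choice ha.
exists (fun i => P *m ((1%:M + E i) *m (invmx P *m w))), w; split=> //.
- move=> i; have [_ hi] := hE i; split.
    rewrite mulmx_neq0 // mulmx_neq0 ?(in_basis_unit uP hi) // mulmx_neq0 //.
    by rewrite unitmx_inv.
  by rewrite -{1}(mulKVmx uP w) (act_line_basis _ uP hi).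
apply/converges_mx => n; have [b hb] := mx_ge_bound v P.
have [b' hb'] := mx_ge_bound v (invmx P *m w).
exists (absz (n - b - b')%R) => i li; have [nE _] := hE i.
rewrite mulmxDl mul1mx mulmxDr mulKVmx // addrC addKr.
have := mx_geM hv hb (mx_geM hv nE hb'); apply: mx_geW.
by clear -li; lia.
Qed.

End Orbits.

Section Discontinuity.
Variables (k : fieldType) (v : k -> int).
Hypothesis hv : discrete_valuation v.
Variable Gamma : set (PGL2 k).
Hypotheses (GammaM : forall x y, Gamma x -> Gamma y -> Gamma (x * y)%g)
  (GammaV : forall x, Gamma x -> Gamma x^-1%g)
  (disc : discontinuous v Gamma).

(** A sequence of non-trivial elements tending to the identity would make every point
    a limit point. *)
Lemma not_accumulating P : P \in unitmx ->
  exists n : nat, forall x, Gamma x -> near1 v P n%:Z x -> x = 1%g.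
Proof.
move=> uP; apply: contrapT => nn.
have hx (n : nat) : exists x, [/\ Gamma x, near1 v P n%:Z x & x <> 1%g].
  apply: contrapT => nx; apply: nn; exists n => x Gx nx1; apply: contrapT => x1.
  by apply: nx; exists x.
have [x xP] := choice hx.
have hs n : exists m : nat, ~ near1 v P m%:Z (x n).
  apply: contrapT => h; have [_ _] := xP n; apply; apply: (near1_separated hv uP).
  by move=> m; apply: contrapT => hm; apply: h; exists m.
have [s sP] := choice hs.
(* Each term is chosen closer to 1 than the previous one is. *)
have [phi phi_lt phi_ge] : exists2 phi : nat -> nat,
    (forall i j, (i < j)%N -> (s (phi i) <= phi j)%N) & forall i, (i <= phi i)%N.
  pose phi i := iter i (fun m => maxn m.+1 (s m)) 0%N; exists phi => [i j|i].
    elim: j => [//|j IH]; rewrite ltnS leq_eqVlt => /orP[/eqP->|/IH h] /=.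
      exact: leq_maxr.
    by apply: leq_trans h _; rewrite leq_max leqnSn.
  by elim: i => [//|i IH] /=; rewrite leq_max ltnS IH.
have neq i j : (i < j)%N -> x (phi i) <> x (phi j).
  move=> /phi_lt ij e; apply: (sP (phi i)); rewrite e.
  have [_ h _] := xP (phi j); by apply: near1W h; rewrite lez_nat.
have inj i j : x (phi i) = x (phi j) -> i = j.
  by have [ij|ij|//] := ltngtP i j; have := neq _ _ ij => h /esym // /h.
have [[l Pl nl] _] := disc; apply: nl; exists l, (x \o phi); split=> //.
  by move=> i; have [] := xP (phi i).
apply: (near1_converges hv uP Pl) => i; have [_ h _] := xP (phi i).
by apply: near1W h; rewrite lez_nat phi_ge.
Qed.

(** The closure of the orbit of the line spanned by [P *m u] is compact. *)
Lemma orbit_subsequence P (g : nat -> PGL2 k) (M : nat -> 'M[k]_2) b u :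
  P \in unitmx -> u != 0 -> mx_ge v 0 u -> (forall i, Gamma (g i)) ->
  (forall i, in_basis P (g i) (M i)) -> (forall i, mx_ge v b (M i)) ->
  exists2 phi : nat -> nat, {homo phi : i j / (i < j)%N} & close_images v (M \o phi) u.
Proof.
move=> uP u0 iu Gg gM bM; have [_ comp] := disc.
have Pl : P1 (line (P *m u)) by exists (P *m u) => //=; exact: mulmx_neq0.
have cl i : P1_closure v [set act_set a (line (P *m u)) | a in Gamma]
    (act_set (g i) (line (P *m u))).
  exists (fun=> act_set (g i) (line (P *m u))); first by move=> _; exists (g i).
  have [w w0 <-] := act_P1 (g i) Pl; exists (fun=> w), w; split=> //.
  by move=> j n; exists 0%N => i' _; rewrite subrr val_ge0.
have [phi [l [hphi _ cv]]] := comp _ Pl _ cl.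
exists phi => //; apply: (converging_lines_close hv (b := b) uP _ _ iu cv).
  by move=> i; exact: gM.
by move=> i; exact: bM.
Qed.

(** Projectively, the three vectors are points in general position, which determine a
    projectivity. *)
Lemma near_scalar n (Q : 'M[k]_2) c1 c2 c :
  mx_ge v n (Q *m col2 1 0 - c1 *: col2 1 0) ->
  mx_ge v n (Q *m col2 0 1 - c2 *: col2 0 1) ->
  mx_ge v n (Q *m col2 1 1 - c *: col2 1 1) -> mx_ge v n (Q - c%:M).
Proof.
rewrite (mat2_eta Q); move: (Q 0 0) (Q 0 1) (Q 1 0) (Q 1 1) => x y z t.
rewrite !mul_mat2_col2 !scale_col2 !mulr0 !mulr1 !addr0 !add0r.
move=> /(_ 1 0) q1 /(_ 0 0) q2 q3; move: (q3 0 0) (q3 1 0) q1 q2.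
rewrite !mxE /= !subr0 => q00 q11 q10 q01.
elim/ord2P; elim/ord2P; rewrite !mxE /= ?subr0 //.
  have -> : x - c = x + y - c - y by ring.
  exact: val_geB.
have -> : t - c = z + t - c - z by ring.
exact: val_geB.
Qed.

(** If infinitely many elements had matrices with bounded entries and the same
    determinant, the images of three points would converge along a
    subsequence, so that quotients of two elements would be as close to the
    identity as desired. *)
Lemma finite_bounded P b d : P \in unitmx -> d != 0 ->
  finite_set [set x | Gamma x /\
    exists M, [/\ in_basis P x M, mx_ge v b M & \det M = d]].
Proof.
move=> uP d0; apply: contrapT => /infiniteP/card_leP[f].
pose f0 := valLR (1%g : PGL2 k) f; pose g := (f0 : nat -> PGL2 k).
have ginj : injective g by move=> i j; apply: inj; rewrite inE.
have gP i : Gamma (g i) /\ exists M, [/\ in_basis P (g i) M, mx_ge v b M & \det M = d].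
  exact: (@funS _ _ _ _ f0).
have [M MP] := choice (fun i => (gP i).2).
have Gg i := (gP i).1.
have gM i : in_basis P (g i) (M i) by have [] := MP i.
have bM i : mx_ge v b (M i) by have [] := MP i.
have dM i : \det (M i) = d by have [] := MP i.
have i1 : val_ge v 0 1 by rewrite val_geE ?oner_neq0 // valuation1.
have nz (x y : k) : x != 0 \/ y != 0 -> col2 x y != 0.
  move=> h; apply/negP => /eqP e.
  have ex : x = 0 by have /matrixP/(_ 0 0) := e; rewrite !mxE.
  have ey : y = 0 by have /matrixP/(_ 1 0) := e; rewrite !mxE.
  by case: h; rewrite ?ex ?ey eqxx.
have e1 : col2 1 0 != 0 :> 'cV[k]_2 by apply: nz; left; rewrite oner_neq0.
have e2 : col2 0 1 != 0 :> 'cV[k]_2 by apply: nz; right; rewrite oner_neq0.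
have e3 : col2 1 1 != 0 :> 'cV[k]_2 by apply: nz; left; rewrite oner_neq0.
have ie1 : mx_ge v 0 (col2 1 0) by apply/mx_ge_col2; rewrite val_ge0.
have ie2 : mx_ge v 0 (col2 0 1) by apply/mx_ge_col2; rewrite val_ge0.
have ie3 : mx_ge v 0 (col2 1 1) by apply/mx_ge_col2.
have [phi1 h1 c1] := orbit_subsequence uP e1 ie1 Gg gM bM.
have [phi2 h2 c2] := @orbit_subsequence P (g \o phi1) (M \o phi1) b _ uP e2 ie2
  (fun i => Gg _) (fun i => gM _) (fun i => bM _).
have [phi3 h3 c3] := @orbit_subsequence P (g \o phi1 \o phi2) (M \o phi1 \o phi2) b _
  uP e3 ie3 (fun i => Gg _) (fun i => gM _) (fun i => bM _).
pose psi := phi1 \o phi2 \o phi3.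
have hpsi : {homo psi : i j / (i < j)%N} by move=> i j /h3/h2/h1.
have {}c2 := close_images_sub h3 c2.
have {}c1 := close_images_sub h3 (close_images_sub h2 c1).
have [n0 nP] := not_accumulating uP; pose n := n0.+1%:Z.
(* Multiplication by the inverse of a matrix costs [b - v d] of precision. *)
have [m1 hm1] := c1 (n - (b - v d)); have [m2 hm2] := c2 (n - (b - v d)).
have [m3 hm3] := c3 (n - (b - v d)).
pose m := maxn m1 (maxn m2 m3).
pose A := M (psi m.+1); pose B := M (psi m).
have uB : B \in unitmx by rewrite unitmx_det dM.
pose Q := invmx B *m A.
have near u c : mx_ge v (n - (b - v d)) (A *m u - c *: (B *m u)) ->
    mx_ge v n (Q *m u - c *: u).
  have := mx_ge_inv hv uB (bM _); rewrite dM => bB h.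
  have := mx_geM hv bB h; rewrite addrC subrK mulmxBr -scalemxAr mulKmx //.
  by rewrite mulmxA.
have le1 : (m1 <= m)%N by rewrite leq_max leqnn.
have le2 : (m2 <= m)%N by rewrite !leq_max leqnn orbT.
have le3 : (m3 <= m)%N by rewrite !leq_max leqnn !orbT.
have [a1 /near near1] := hm1 _ _ (leqW le1) le1.
have [a2 /near near2] := hm2 _ _ (leqW le2) le2.
have [c /near near3] := hm3 _ _ (leqW le3) le3.
have nE := near_scalar near1 near2 near3.
have dQ : \det Q = 1 by rewrite det_mulmx det_inv !dM mulVf.
(* The scalar is not small since the determinant is 1. *)
have vc : c != 0 /\ v c <= 0.
  suff nc : ~~ val_ge v 1 c.
    have c0 : c != 0 by apply: contra nc => /eqP ->; rewrite val_ge0.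
    by split=> //; move: nc; rewrite val_geE // -ltNge; rewrite -ltzD1.
  apply/negP => c1'; have : mx_ge v 1 Q.
    rewrite -[Q](subrK c%:M) addrC; apply: mx_geD => //.
      by elim/ord2P; elim/ord2P; rewrite !mxE ?val_ge0.
    by apply: mx_geW nE; rewrite /n; clear; lia.
  by move=> /(mx_ge_det hv); rewrite dQ val_geE ?oner_neq0 // valuation1.
have [c0 cv] := vc.
have gx : in_basis P ((g (psi m))^-1 * g (psi m.+1))%g Q.
  by apply: in_basisM => //; apply: in_basisV.
have : ((g (psi m))^-1 * g (psi m.+1) = 1)%g.
  apply: nP; first by apply: GammaM; [apply/GammaV/Gg|exact: Gg].
  exists (c^-1 *: Q - 1%:M); split; last first.
    by rewrite addrC subrK; apply: in_basis_scale => //; rewrite invr_eq0.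
  have -> : c^-1 *: Q - 1%:M = c^-1 *: (Q - c%:M).
    by rewrite scalerBr scale_scalar_mx mulVf.
  apply/mx_ge_scale => //; first by rewrite invr_eq0.
  apply: mx_geW nE; rewrite valuationV // /n; clear -cv; lia.
move/(congr1 (fun x => g (psi m) * x)%g); rewrite mulVKg mulg1 => /ginj e.
by have := hpsi _ _ (ltnSn m); rewrite e ltnn.
Qed.

End Discontinuity.

Section FreeSubgroups.
Variables (gT : groupType) (A : set gT).

Lemma normalizer_conj n a : normalizer A n -> A a -> A (n * a * n^-1)%g.
Proof. by move=> nA Aa; rewrite -nA; exists a. Qed.

Lemma normalizer1 : normalizer A 1%g.
Proof.
apply/seteqP; split=> [_ [a Aa <-]|a Aa]; first by rewrite mul1g invg1 mulg1.
by exists a; rewrite // mul1g invg1 mulg1.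
Qed.

Lemma normalizerM m n : normalizer A m -> normalizer A n -> normalizer A (m * n)%g.
Proof.
move=> mA nA; apply/seteqP; split=> [_ [a Aa <-]|a].
  rewrite invgM !mulgA -(mulgA m n a) -(mulgA m (n * a)%g).
  by do 2!apply: normalizer_conj => //.
rewrite -{1}mA => -[b + <-]; rewrite -{1}nA => -[c Ac <-].
by exists c; rewrite // invgM !mulgA.
Qed.

Lemma normalizerV n : normalizer A n -> normalizer A n^-1%g.
Proof.
move=> nA; apply/seteqP; split=> [_ [a + <-]|a Aa].
  rewrite -{1}nA => -[b Ab <-].
  by rewrite invgK !mulgA mulVg mul1g mulgVK.
exists (n * a * n^-1)%g; first exact: normalizer_conj.
by rewrite invgK !mulgA mulVg mul1g mulgVK.
Qed.

Variable r : nat.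
Hypothesis fA : free_of_rank r A.

Lemma free_subgroup : [/\ A 1%g, forall x y, A x -> A y -> A (x * y)%g &
  forall x, A x -> A x^-1%g].
Proof.
case: fA => a [-> _]; set eval := (eval in range eval).
have ec w1 w2 : eval (w1 ++ w2) = (eval w1 * eval w2)%g.
  by elim: w1 => [|l w IH] /=; rewrite ?mul1g // IH mulgA.
split=> [|_ _ [w1 _ <-] [w2 _ <-]|_ [w _ <-]].
- by exists [::].
- by exists (w1 ++ w2).
elim: w => [|[i b] w [w' _ IH]]; first by exists [::]; rewrite //= invg1.
exists (w' ++ [:: (i, ~~ b)]) => //; rewrite ec IH /= mulg1 invgM.
by case: b; rewrite /= ?invgK.
Qed.

(** Squares are needed because projectivities commute as soon as their matrices commute
    up to a sign, which disappears on squares. *)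
Lemma free_noncommuting_squares : (2 <= r)%N -> exists a b,
  [/\ A a, A b & a * a * (b * b) <> b * b * (a * a)]%g.
Proof.
case: r fA => [//|[//|m]] [a [-> fr]] _; set eval := (eval in range eval).
pose i0 : 'I_m.+2 := ord0; pose i1 : 'I_m.+2 := lift ord0 ord0.
exists (a i0), (a i1); split.
- by exists [:: (i0, true)]; rewrite //= mulg1.
- by exists [:: (i1, true)]; rewrite //= mulg1.
move=> e; pose w := [:: (i0, true); (i0, true); (i1, true); (i1, true);
  (i0, false); (i0, false); (i1, false); (i1, false)].
have reduced_w : all (fun j => let x := nth (i0, true) w j in
    let y := nth (i0, true) w j.+1 in (x.1 != y.1) || (x.2 == y.2)) (iota 0 7) by [].
have : w = [::]; last by [].
apply: fr; last first.
  by rewrite !mulgA in e; rewrite /= mulg1 !mulgA e !mulgK mulgV.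
move=> w1 i b w2 ew; have szw : size w = (size w1 + (size w2).+2)%N.
  by rewrite {1}ew size_cat.
have /(allP reduced_w) : size w1 \in iota 0 7.
  by move: szw; rewrite mem_iota /=; clear; lia.
by rewrite ew !nth_cat ltnn subnn ltnNge leqnSn subSnn /= eqxx; case: b {ew}.
Qed.

End FreeSubgroups.

Section Stabilizers.
Variables (k : fieldType) (v : k -> int).
Hypothesis hv : discrete_valuation v.

(** The commutant of a non scalar matrix consists of the polynomials in that matrix. *)
Lemma commutant_mat2 (Z X : 'M[k]_2) :
  ~ [/\ Z 0 1 = 0, Z 1 0 = 0 & Z 0 0 = Z 1 1] -> Z *m X = X *m Z ->
  exists a b, X = a%:M + b *: Z.
Proof.
rewrite (mat2_eta X) (mat2_eta Z) !mul_mat2.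
move: (X 0 0) (X 0 1) (X 1 0) (X 1 1) => x1 x2 x3 x4.
move: (Z 0 0) (Z 0 1) (Z 1 0) (Z 1 1) => z1 z2 z3 z4.
have [-> -> -> ->] := mat2E z1 z2 z3 z4 => ns /matrixP e.
have e1 : z2 * x3 = x2 * z3.
  by have := e 0 0; rewrite !mxE /= [z1 * _]mulrC => /addrI.
have e2 : z2 * (x1 - x4) = x2 * (z1 - z4).
  have := e 0 1; rewrite !mxE /= => e2.
  have -> : z2 * (x1 - x4) = x1 * z2 + x2 * z4 - z2 * x4 - x2 * z4 by ring.
  by rewrite -e2; ring.
have e3 : z3 * (x1 - x4) = x3 * (z1 - z4).
  have := e 1 0; rewrite !mxE /= => e3.
  have -> : z3 * (x1 - x4) = z3 * x1 + z4 * x3 - z4 * x3 - z3 * x4 by ring.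
  by rewrite e3; ring.
have shape a b : x1 = a + b * z1 -> x2 = b * z2 -> x3 = b * z3 -> x1 - x4 = b * (z1 - z4) ->
    exists a b, mat2 x1 x2 x3 x4 = a%:M + b *: mat2 z1 z2 z3 z4.
  move=> h1 h2 h3 h4; exists a, b.
  have h4' : x4 = a + b * z4.
    by rewrite -[x4](subKr x1) h4 h1; ring.
  by apply/matrixP; elim/ord2P; elim/ord2P; rewrite !mxE /= ?add0r.
have [z20|z20] := eqVneq z2 0; last first.
  apply: (shape (x1 - x2 / z2 * z1) (x2 / z2)); first by rewrite subrK.
  - by rewrite divfK.
  - by apply: (mulfI z20); rewrite e1; field.
  - by apply: (mulfI z20); rewrite e2; field.
have [z30|z30] := eqVneq z3 0; last first.
  apply: (shape (x1 - x3 / z3 * z1) (x3 / z3)); first by rewrite subrK.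
  - by apply: (mulfI z30); rewrite mulrC -e1; field.
  - by rewrite divfK.
  - by apply: (mulfI z30); rewrite e3; field.
have z14 : z1 - z4 != 0.
  by rewrite subr_eq0; apply/negP => /eqP z14; apply: ns.
apply: (shape (x1 - (x1 - x4) / (z1 - z4) * z1) ((x1 - x4) / (z1 - z4))).
- by rewrite subrK.
- by apply: (mulIf z14); rewrite -e2 z20 !mulr0 !mul0r.
- by apply: (mulIf z14); rewrite -e3 z30 !mulr0 !mul0r.
- by rewrite divfK.
Qed.

Lemma commute_polys (Z : 'M[k]_2) a b c d :
  (a%:M + b *: Z) *m (c%:M + d *: Z) = (c%:M + d *: Z) *m (a%:M + b *: Z).
Proof.
rewrite !mulmxDl !mulmxDr -!scalemxAl -!scalemxAr !mul_scalar_mx !mul_mx_scalar.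
rewrite !scalerA !scale_scalar_mx [c * a]mulrC [d * b]mulrC -!addrA; congr (_ + _).
by rewrite addrCA [b * c]mulrC [d * a]mulrC.
Qed.

(** A matrix of [z] commutes up to sign with matrices of [a] and [b], hence commutes
    with their squares.  If it were not scalar, both squares would be polynomials in it
    and would commute. *)
Lemma centralizer_trivial (a b z : PGL2 k) : (a * a * (b * b) <> b * b * (a * a))%g ->
  (z * a = a * z)%g -> (z * b = b * z)%g -> z = 1%g.
Proof.
move=> nab za zb; have u1 : 1%:M \in @unitmx k 2 := unitmx1 _ _.
have [m hm] : exists m : PGL2 k -> 'M[k]_2, forall x, in_basis 1%:M x (m x).
  by exists (fun x => invmx 1%:M *m matrix_of x *m 1%:M) => x; exact: in_basis_self.
have sq x : (z * x = x * z)%g -> m z *m (m x *m m x) = (m x *m m x) *m m z.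
  move=> zx; have [c c0 e] : exists2 c : k, c != 0 & m z *m m x = c *: (m x *m m z).
    have [c c0 e] := in_basisM u1 (hm z) (hm x).
    have [d d0 f] := in_basisM u1 (hm x) (hm z).
    exists (c / d); first by rewrite mulf_neq0 ?invr_eq0.
    by rewrite e f zx scalerA divfK.
  have c2 : c * c = 1.
    have dn y : \det (m y) != 0 by rewrite -unitmx_det (in_basis_unit u1 (hm y)).
    have := congr1 determinant e.
    rewrite detZ !det_mulmx expr2 (mulrC (\det (m x)) (\det (m z))) => h.
    by apply: (mulIf (mulf_neq0 (dn z) (dn x))); rewrite mul1r -h.
  by rewrite mulmxA e -scalemxAl -mulmxA e -scalemxAr scalerA c2 scale1r mulmxA.
have {sq za zb} [ca cb] := (sq _ za, sq _ zb).
have ncomm : m a *m m a *m (m b *m m b) <> m b *m m b *m (m a *m m a).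
  have sq2 x y : in_basis 1%:M (x * x * (y * y))%g (m x *m m x *m (m y *m m y)).
    by apply: (in_basisM u1); apply: (in_basisM u1); exact: hm.
  by move=> e; apply: nab; apply: (in_basis_inj u1 (sq2 a b)); rewrite e; exact: sq2.
have [|ns] := pselect ([/\ m z 0 1 = 0, m z 1 0 = 0 & m z 0 0 = m z 1 1]).
  case=> z01 z10 z11; apply: (in_basis_inj u1 (hm z)).
  have := in_basis_unit u1 (hm z); rewrite unitmx_det (mat2_eta (m z)) z01 z10 -z11.
  rewrite det_mat2 mul0r subr0 mulf_eq0 orbb => z0.
  have -> : mat2 (m z 0 0) 0 0 (m z 0 0) = m z 0 0 *: 1%:M.
    by rewrite mat2_1 scale_mat2 mulr0 mulr1.
  by apply: in_basis_scale => //; exact: in_basis1.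
have [[al [be ea]] [ga [de eb]]] := (commutant_mat2 ns ca, commutant_mat2 ns cb).
by case: ncomm; rewrite ea eb commute_polys.
Qed.

Variable Gamma : set (PGL2 k).
Hypotheses (GammaM : forall x y, Gamma x -> Gamma y -> Gamma (x * y)%g)
  (GammaV : forall x, Gamma x -> Gamma x^-1%g)
  (disc : discontinuous v Gamma).

Lemma act_vertex_of x A : act_vertex x (vertex_of v A) = vertex_of v (matrix_of x *m A).
Proof.
apply/seteqP; split=> [_ [L /mem_vertex_of[c c0 ->] <-]|L /mem_vertex_of[c c0 ->]].
  apply/mem_vertex_of; exists c => //; rewrite scalemxAr.
  apply/seteqP; split=> [_ [_ [w wi <-] <-]|_ [w wi <-]].
    by exists w; rewrite // mulmxA.
  by exists (c *: A *m w); [exists w|rewrite mulmxA].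
exists (lattice_of v (c *: A)); first by apply/mem_vertex_of; exists c.
rewrite scalemxAr; apply/seteqP; split=> [_ [_ [w wi <-] <-]|_ [w wi <-]].
  by exists w; rewrite // mulmxA.
by exists (c *: A *m w); [exists w|rewrite mulmxA].
Qed.

Lemma act_vertex_of_basis P x M A : P \in unitmx -> A \in unitmx -> in_basis P x M ->
  act_vertex x (vertex_of v (P *m A)) = vertex_of v (P *m (M *m A)).
Proof.
move=> uP uA hM; have uM := in_basis_unit uP hM.
have [c c0 e] := in_basis_matrix uP hM.
by rewrite act_vertex_of mulmxA e -scalemxAl vertex_of_scale ?mulmxA // !unitmx_mul uP uM.
Qed.

Lemma stabilizer_basis P x : P \in unitmx -> act_vertex x (vertex_of v P) = vertex_of v P ->
  exists2 U, GLO v U & in_basis P x U.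
Proof.
move=> uP; rewrite act_vertex_of => /esym/vertex_of_eq.
case=> //; first by rewrite unitmx_mul uP matrix_of_unit.
move=> c [U [c0 gU e]]; exists U => //; exists c^-1; first by rewrite invr_eq0.
by rewrite -mulmxA e scalerA mulVf // scale1r.
Qed.

(** An element of the normalizer fixing a vertex is determined by the conjugates
    of two non commuting elements of [Gamma], whose matrices are bounded in
    terms of those two elements only. *)
Lemma finite_stabilizer a b x : Gamma a -> Gamma b ->
  (a * a * (b * b) <> b * b * (a * a))%g -> verts (bt_tree v) x ->
  finite_set [set n | normalizer Gamma n /\ act_vertex n x = x].
Proof.
move=> Ga Gb nab /bt_vertP[P uP ->].
have conj_finite c : Gamma c -> exists2 F, finite_set F &
    forall n, normalizer Gamma n -> act_vertex n (vertex_of v P) = vertex_of v P ->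
      F (n * c * n^-1)%g.
  have [A hA] : exists A, in_basis P c A by eexists; exact: in_basis_self.
  move=> Gc; have uA := in_basis_unit uP hA; have [m mA] := mx_ge_bound v A.
  have dA : \det A != 0 by rewrite -unitmx_det.
  eexists; first exact: (finite_bounded hv GammaM GammaV disc m uP dA).
  move=> n Nn /(stabilizer_basis uP)[U [iU uU iU'] hU]; split.
    exact: normalizer_conj.
  exists (U *m A *m invmx U); split.
  - by do 2?[apply: (in_basisM uP) => //]; apply: (in_basisV uP).
  - by have := mx_geM hv (mx_geM hv iU mA) iU'; rewrite add0r addr0.
  - rewrite !det_mulmx det_inv mulrAC divff ?mul1r //.
    by rewrite -unitmx_det.
have [[Fa fa hFa] [Fb fb hFb]] := (conj_finite a Ga, conj_finite b Gb).
pose f n := (n * a * n^-1, n * b * n^-1)%g.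
apply: (sub_finite_set (B := f @^-1` (Fa `*` Fb))).
  by move=> n [Nn nP]; split=> /=; [exact: hFa|exact: hFb].
apply: finite_preimage; last exact: finite_setX.
move=> m n _ _ [ea eb]; have conj_eq c : (m * c * m^-1 = n * c * n^-1 ->
    n^-1 * m * c = c * (n^-1 * m))%g.
  move=> e; have : (n^-1 * (m * c * m^-1) * m = n^-1 * (n * c * n^-1) * m)%g by rewrite e.
  by rewrite !mulgA mulgVK mulVg mul1g.
have := centralizer_trivial nab (conj_eq _ ea) (conj_eq _ eb).
by move/(congr1 (fun z => n * z)%g); rewrite mulgA mulgV mul1g mulg1.
Qed.

End Stabilizers.

(** * Fixed points of the stabilizers *)

Section FiniteGroups.
Variables (gT : groupType) (H : set gT).
Hypotheses (H1 : H 1%g) (HM : forall x y, H x -> H y -> H (x * y)%g) (finH : finite_set H).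

Lemma finite_group_order x : H x -> finite_order x.
Proof.
move=> Hx; apply: contrapT => nf.
have Hxn n : H (x ^+ n)%g by elim: n => [//|n IH]; rewrite expgS; exact: HM.
have lt_neq i j : (i < j)%N -> (x ^+ i <> x ^+ j)%g.
  move=> ij e; apply: nf; exists (j - i)%N; first by rewrite subn_gt0.
  by apply: (mulgI (x ^+ i)%g); rewrite -expgnDr subnKC ?mulg1 // ltnW.
apply: infinite_nat; have : finite_set ((fun n => x ^+ n)%g @^-1` H).
  apply: finite_preimage finH => i j _ _ e.
  by have [ij|ij|//] := ltngtP i j; have := lt_neq _ _ ij; rewrite e.
by apply: sub_finite_set => n _; exact: Hxn.
Qed.

(** Jordan: in a transitive action on at least two points, some element fixes nothing.
    Let [t x] send [e] to [x].  The map [h |-> h (t (h e))^-1] sends each [h] to an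
    element fixing [h e]; it is onto when every element fixes a point, hence injective,
    but it sends all the [t x] to 1. *)
Lemma transitive_fixed_points (T : Type) (act : gT -> T -> T) (X : set T) e :
  X e -> (forall h x, H h -> X x -> X (act h x)) ->
  (forall g h x, H g -> H h -> X x -> act (g * h)%g x = act g (act h x)) ->
  (forall x, X x -> act 1%g x = x) ->
  (forall x, X x -> exists2 h, H h & x = act h e) ->
  (forall h, H h -> exists2 x, X x & act h x = x) ->
  forall x, X x -> x = e.
Proof.
move=> Xe Xact actM act1 trans fix_.
have tP x : exists h, X x -> H h /\ x = act h e.
  have [/trans[h Hh xh]|nx] := pselect (X x); last by exists 1%g.
  by exists h.
have [t {}tP] := choice tP.
pose phi h := (h * (t (act h e))^-1)%g.
have phi_onto h : H h -> exists2 g, H g & phi g = h.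
  move=> Hh; have [x Xx hx] := fix_ h Hh; have [Ht xt] := tP x Xx.
  exists (h * t x)%g; first exact: HM.
  by rewrite /phi actM // -xt hx mulgK.
have /finite_seqP[s0 eH] := finH; pose s := undup s0.
have sP h : (h \in s) <-> H h by rewrite eH mem_undup.
have uphi : uniq (map phi s).
  apply: (leq_size_uniq (undup_uniq s0)); last by rewrite size_map.
  move=> h /sP /phi_onto[g /sP gs <-]; exact: map_f.
have phi_inj g h : H g -> H h -> phi g = phi h -> g = h.
  move=> /sP gs /sP hs e1; rewrite -(nth_index 1%g gs) -(nth_index 1%g hs).
  congr nth; apply/eqP; rewrite -(nth_uniq 1%g _ _ uphi) ?size_map ?index_mem //.
  by rewrite !(nth_map 1%g) ?index_mem // !nth_index // e1.
move=> x Xx; have [Htx ex] := tP x Xx; have [Hte ee] := tP e Xe.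
have phi1 y : X y -> phi (t y) = 1%g.
  by move=> Xy; have [_ ey] := tP y Xy; rewrite /phi -ey mulgV.
by rewrite {1}ex (phi_inj _ _ Htx Hte) -?ee // !phi1.
Qed.

End FiniteGroups.

(** An eigenvector exists after adjoining a root of the characteristic polynomial; by
    rationality it is a multiple of a vector over [k], whose eigenvalue is then in [k]. *)
Lemma torsion_eigenvector (k : fieldType) (N : set (PGL2 k)) n :
  torsion_fixed_points_rational N -> N n -> n <> 1%g -> finite_order n ->
  exists (w : 'cV[k]_2) (e : k), w != 0 /\ matrix_of n *m w = e *: w.
Proof.
move=> rat Nn n1 fn; set A := matrix_of n.
have of_root (K : fieldType) (B : 'M[K]_2) c : root (char_poly B^T) c ->
    exists2 u : 'cV[K]_2, u != 0 & B *m u = c *: u.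
  rewrite -eigenvalue_root_char => /eigenvalueP[u uB u0]; exists u^T.
    by apply: contra u0 => /eqP u0; rewrite -[u]trmxK u0 trmx0.
  by rewrite -[B]trmxK -trmx_mul uB linearZ.
have [[c rc]|nr] := pselect (exists c, root (char_poly A^T) c).
  by have [w w0 wA] := of_root _ _ _ rc; exists w, c.
have irr : irreducible_poly (char_poly A^T).
  apply: cubic_irreducible; first by rewrite size_char_poly.
  by move=> c; apply/negP => rc; apply: nr; exists c.
have [L _ [z rz _]] := irredp_FAdjoin irr.
pose iota : {rmorphism k -> L} := in_alg L.
have {}rz : root (char_poly (map_mx iota A)^T) z by rewrite map_trmx -map_char_poly.
have [u u0 uA] := of_root _ _ _ rz.
have [w [d ud]] := rat n Nn n1 fn L iota u z u0 uA.
have d0 : d != 0 by apply: contra u0 => /eqP d0; rewrite ud d0 scale0r.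
have w0 : w != 0 by apply: contra u0 => /eqP w0; rewrite ud w0 map_mx0 scaler0.
have Aw : map_mx iota (A *m w) = z *: map_mx iota w.
  rewrite map_mxM; apply: (scalerI d0); move: uA; rewrite ud -scalemxAr => ->.
  by rewrite !scalerA mulrC.
have [i wi] : exists i, w i 0 != 0.
  have [z0|?] := eqVneq (w 0 0) 0; last by exists 0.
  have [z1|?] := eqVneq (w 1 0) 0; last by exists 1.
  by case/negP: w0; apply/eqP/matrixP; elim/ord2P => i; rewrite ord1 [RHS]mxE.
have ez : z = iota ((A *m w) i 0 / w i 0).
  have /matrixP/(_ i 0) := Aw; rewrite [LHS]mxE [RHS]mxE [map_mx _ _ _ _]mxE fmorph_div => ->.
  by rewrite mulfK // fmorph_eq0.
exists w, ((A *m w) i 0 / w i 0); split=> //.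
by apply: (map_mx_inj (f := iota)); rewrite Aw map_mxZ -ez.
Qed.

(** * The subtree spanned by the limit points and the fixed points *)

Section TreeStar.
Variables (k : fieldType) (v : k -> int).
Hypothesis hv : discrete_valuation v.
Variable pi : k.
Hypotheses (pi0 : pi != 0) (vpi : v pi = 1).
Local Notation vertex_of := (vertex_of v).
Local Notation step := (stepmx pi).
Local Notation bt := (bt_tree v).
Implicit Types (P : 'M[k]_2) (w : 'cV[k]_2).

Let sbt : serre_graph bt := bt_serre hv pi0 vpi.
Let abt : acyclic bt := bt_acyclic hv pi0 vpi.
Let cbt : connected bt := bt_connected hv pi0 vpi.

Lemma adjacentP x y : verts bt x -> verts bt y -> adjacent v x y <->
  exists P, [/\ P \in unitmx, x = vertex_of P & y = vertex_of (P *m step)].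
Proof.
move=> vx vy; split=> [|[P [uP -> ->]]]; last exact: adjacent_step.
have /bt_vertP[P uP ->] := vx => /(adjacent_cases hv pi0 vpi uP vy)[->|[b ib ->]].
  by exists P.
have v10 : val_ge v 0 1 by rewrite val_geE ?oner_neq0 // valuation1.
have gU : GLO v (mat2 b 1 1 0).
  apply: GLO_mat2; rewrite ?val_ge0 // mulr0 mul1r sub0r ?oppr_eq0 ?oner_neq0 //.
  by rewrite valuationN ?oner_neq0 // valuation1.
have uPU : P *m mat2 b 1 1 0 \in unitmx by rewrite unitmx_mul uP; case: gU.
exists (P *m mat2 b 1 1 0); split=> //.
  by rewrite (vertex_of_mulGLO hv uP (GLO_homothetic gU)).
rewrite -[RHS](vertex_of_mulGLO hv _ (GLO_homothetic (swap_GLO hv))); last first.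
  by rewrite unitmx_mul uPU step_unit.
by rewrite /stepmx -!mulmxA !mul_mat2 !(mulr0, mul0r, mulr1, mul1r, addr0, add0r).
Qed.

Lemma diag_unit P a d : P \in unitmx -> a != 0 -> d != 0 ->
  P *m mat2 a 0 0 d \in unitmx.
Proof.
by move=> uP a0 d0; rewrite unitmx_mul uP unitmx_det det_mat2 mulr0 subr0 mulf_neq0.
Qed.

(** In an apartment, the difference of the two valuations is a coordinate along the
    line. *)
Lemma vertex_of_diag P a d a' d' : P \in unitmx -> a != 0 -> d != 0 -> a' != 0 -> d' != 0 ->
  vertex_of (P *m mat2 a 0 0 d) = vertex_of (P *m mat2 a' 0 0 d') -> v a + v d' = v a' + v d.
Proof.
move=> uP a0 d0 a'0 d'0; have uD := diag_unit uP a0 d0.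
move=> /(vertex_of_eq hv uD (diag_unit uP a'0 d'0)) [c [U [c0 gU e]]].
have : mat2 a' 0 0 d' = mat2 a 0 0 d *m (c *: U).
  by rewrite -e; apply: (can_inj (mulKmx uP)); rewrite mulmxA mulKVmx.
rewrite -scalemxAr => e'.
have [iU uU iU'] := gU; rewrite (mat2_eta U) mul_mat2 scale_mat2 in e'.
have e00 : a' = c * (a * U 0 0).
  by have /matrixP/(_ 0 0) := e'; rewrite !mxE /= !mul0r addr0.
have e11 : d' = c * (d * U 1 1).
  by have /matrixP/(_ 1 1) := e'; rewrite !mxE /= mul0r add0r.
have e01 : 0 = c * (a * U 0 1).
  by have /matrixP/(_ 0 1) := e'; rewrite !mxE /= mul0r addr0.
have U01 : U 0 1 = 0 by apply: (mulfI a0); apply: (mulfI c0); rewrite -e01 !mulr0.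
have := GLO_det hv gU; rewrite (mat2_eta U) det_mat2 U01 mul0r subr0.
have U00 : U 0 0 != 0.
  by apply/negP => /eqP z; move: a'0; rewrite e00 z !mulr0 eqxx.
have U11 : U 1 1 != 0.
  by apply/negP => /eqP z; move: d'0; rewrite e11 z !mulr0 eqxx.
have := iU 0 0; have := iU 1 1; rewrite !val_geE // (valuationM hv) //.
rewrite e00 e11 !(valuationM hv) ?mulf_neq0 //.
by move: (v _) (v _) (v _) (v _) (v _) => x y z t u; clear; lia.
Qed.

(** The half-line from the class of [P] towards the end given by the first
    column of [P]. *)
Definition ray P (i : nat) : vertex k := vertex_of (P *m mat2 1 0 0 (pi ^+ i)).

Lemma ray_unit P i : P \in unitmx -> P *m mat2 1 0 0 (pi ^+ i) \in unitmx.
Proof. by move=> uP; apply: diag_unit; rewrite ?oner_neq0 ?expf_neq0. Qed.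

Lemma ray0 P : ray P 0 = vertex_of P.
Proof. by rewrite /ray expr0 -mat2_1 mulmx1. Qed.

Lemma ray_step P i : ray P i.+1 = vertex_of (P *m mat2 1 0 0 (pi ^+ i) *m step).
Proof.
by rewrite /ray -mulmxA mul_mat2 !mulr0 !mul0r !mul1r !addr0 !add0r exprSr.
Qed.

Lemma ray_edge P i : P \in unitmx -> edges bt (ray P i, ray P i.+1).
Proof.
move=> uP; split=> /=; [exact/bt_vertex_of/ray_unit|exact/bt_vertex_of/ray_unit|].
by rewrite ray_step; apply: adjacent_step => //; exact: ray_unit.
Qed.

Lemma ray_neq P i j : P \in unitmx -> ray P i = ray P j -> i = j.
Proof.
move=> uP /(vertex_of_diag uP); rewrite oner_neq0 !expf_neq0 // => /(_ isT isT isT isT).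
have vX n : v (pi ^+ n) = n%:Z by exact: (valuation_piX hv pi0 vpi n%:Z).
by rewrite !vX valuation1 // !add0r => -[].
Qed.

Lemma ray_walk P i : P \in unitmx ->
  exists p, [/\ size p = i, walk bt (ray P 0) p (ray P i), reduced bt p &
    forall j, (j < i)%N -> nth (ray P 0, ray P 0) p j = (ray P j, ray P j.+1)].
Proof.
move=> uP; exists (map (fun j => (ray P j, ray P j.+1)) (iota 0 i)).
split; first by rewrite size_map size_iota.
- elim: i => [|i IH]; first by split=> //; exact/bt_vertex_of/ray_unit.
  rewrite -addn1 iotaD map_cat; apply: walk_cat IH _.
  by rewrite add0n addn1; apply: (walk_edge sbt); exact: ray_edge.
- elim: i 0%N => [//|i IH] s; first exact: reduced_nil.
  case: i IH => [|i] IH; first exact: reduced1.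
  apply/reduced_cons2; split; last exact: IH.
  by case=> /(ray_neq uP); clear; lia.
- by move=> j ji; rewrite (nth_map 0%N) ?size_iota // nth_iota.
Qed.

(** If [w] has coordinates [a], [b] in the basis [P], then [b != 0] and a high power of
    [pi] makes [a / b] integral: from there on, the second basis vector can be replaced by
    a multiple of [w]. *)
Lemma ray_apartment P w : P \in unitmx -> w != 0 -> line w <> line (col 0 P) ->
  exists i, apartment v (line (col 0 P)) (line w) (ray P i.+1).
Proof.
move=> uP w0 lw; have ew : w = P *m (invmx P *m w) by rewrite mulKVmx.
move: (invmx P *m w) ew => q; rewrite (col2_eta q); move: (q 0 0) (q 1 0) => a b ew.
have eP M : col 0 (P *m M) = P *m col 0 M by rewrite !colE mulmxA.
have e0 : col 0 P = P *m col2 1 0 by rewrite -[P in LHS]mulmx1 eP mat2_1 (col_mat2 _ _ _ _).1.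
have b0 : b != 0.
  apply/negP => /eqP b0; apply: lw; rewrite e0 ew b0.
  have a0 : a != 0.
    apply/negP => /eqP a0; case/negP: w0; rewrite ew b0 a0.
    have -> : col2 0 0 = 0 :> 'cV[k]_2; last by rewrite mulmx0.
    by apply/matrixP; elim/ord2P => j; rewrite !mxE.
  have -> : col2 a 0 = a *: col2 1 0 by rewrite scale_col2 mulr1 mulr0.
  by rewrite -scalemxAr line_scale.
pose i := (absz (v (a / b))).+1; pose x := pi ^+ i * (a / b); exists (absz (v (a / b))).
have ix : val_ge v 0 x.
  have vX n : v (pi ^+ n) = n%:Z by exact: (valuation_piX hv pi0 vpi n%:Z).
  rewrite val_ge_mull ?expf_neq0 // vX /i; rewrite /val_ge; case: eqP => //= _.
  by clear; lia.
have v10 : val_ge v 0 1 by rewrite val_geE ?oner_neq0 // valuation1.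
have gU : GLO v (mat2 1 x 0 1).
  by apply: GLO_mat2; rewrite ?val_ge0 // mulr1 mulr0 subr0 ?oner_neq0 ?valuation1.
have DU : mat2 1 0 0 (pi ^+ i) *m mat2 1 x 0 1 = mat2 1 x 0 (pi ^+ i).
  by rewrite mul_mat2 !(mulr0, mul0r, mulr1, mul1r, addr0, add0r).
exists (P *m mat2 1 x 0 (pi ^+ i)); split.
- by rewrite unitmx_mul uP unitmx_det det_mat2 mul1r mulr0 subr0 expf_neq0.
- by rewrite eP (col_mat2 _ _ _ _).1 e0.
- rewrite colE -mulmxA -colE (col_mat2 _ _ _ _).2 ew.
  have -> : col2 x (pi ^+ i) = (pi ^+ i / b) *: col2 a b.
    by rewrite scale_col2 divfK // mulrAC -mulrA.
  by rewrite -scalemxAr line_scale // mulf_neq0 ?expf_neq0 ?invr_eq0.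
by rewrite -DU mulmxA -[LHS](vertex_of_mulGLO hv (ray_unit i uP) (GLO_homothetic gU)).
Qed.

(** Some multiple of [w] belongs to a basis of the lattice, so that the vertex is the
    origin of a half-line towards [line w]. *)
Lemma vertex_of_first_column P w : P \in unitmx -> w != 0 ->
  exists Q, [/\ Q \in unitmx, vertex_of Q = vertex_of P & line (col 0 Q) = line w].
Proof.
move=> uP w0; have ew : w = P *m (invmx P *m w) by rewrite mulKVmx.
have q0 : invmx P *m w != 0 by rewrite mulmx_neq0 ?unitmx_inv.
move: (invmx P *m w) q0 ew => q; rewrite (col2_eta q).
move: (q 0 0) (q 1 0) => a b q0 ew.
have v10 : val_ge v 0 1 by rewrite val_geE ?oner_neq0 // valuation1.
(* The coordinate of smallest valuation is scaled to 1. *)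
have main (c : k) (U : 'M[k]_2) : c != 0 -> GLO v U -> col 0 U = c *: col2 a b ->
    exists Q, [/\ Q \in unitmx, vertex_of Q = vertex_of P & line (col 0 Q) = line w].
  move=> c0 gU eU; exists (P *m U); split.
  - by rewrite unitmx_mul uP; case: gU.
  - exact: (vertex_of_mulGLO hv uP (GLO_homothetic gU)).
  - by rewrite colE -mulmxA -colE eU -scalemxAr -ew line_scale.
have [[a0 ab]|nab] := pselect (a != 0 /\ val_ge v (v a) b).
  apply: (main a^-1 (mat2 1 0 (a^-1 * b) 1)); first by rewrite invr_eq0.
    apply: GLO_mat2; rewrite ?val_ge0 ?mulr1 ?mul0r ?subr0 ?oner_neq0 ?valuation1 //.
    by rewrite val_ge_mull ?invr_eq0 // valuationV // opprK add0r.
  by rewrite (col_mat2 _ _ _ _).1 scale_col2 mulVf.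
have b0 : b != 0.
  apply/negP => /eqP b0; apply: nab; rewrite b0 val_ge0; split=> //.
  apply/negP => /eqP a0; case/negP: q0; rewrite a0 b0; apply/eqP/matrixP.
  by elim/ord2P => j; rewrite !mxE.
have ba : val_ge v (v b) a.
  have [->|a0] := eqVneq a 0; first exact: val_ge0.
  rewrite val_geE //; have [//|lt] := leP (v b) (v a).
  by case: nab; split=> //; rewrite val_geE // ltW.
apply: (main b^-1 (mat2 (b^-1 * a) 1 1 0)); first by rewrite invr_eq0.
  apply: GLO_mat2; rewrite ?val_ge0 ?mulr0 ?mul1r ?sub0r ?oppr_eq0 ?oner_neq0
    ?valuationN ?oner_neq0 ?valuation1 //.
  by rewrite val_ge_mull ?invr_eq0 // valuationV // opprK add0r.
by rewrite (col_mat2 _ _ _ _).1 scale_col2 mulVf.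
Qed.

End TreeStar.

Section SpannedSubtree.
Variables (k : fieldType) (v : k -> int).
Hypothesis hv : discrete_valuation v.
Variable pi : k.
Hypotheses (pi0 : pi != 0) (vpi : v pi = 1).
Local Notation vertex_of := (vertex_of v).
Local Notation bt := (bt_tree v).
Variable S : set (set 'cV[k]_2).
Hypothesis SP1 : forall l, S l -> P1 l.
Local Notation X := (spanned_subtree v S).
Local Notation star := (induced bt X).
Implicit Types (P : 'M[k]_2) (x y z : vertex k).

Let sbt : serre_graph bt := bt_serre hv pi0 vpi.
Let abt : acyclic bt := bt_acyclic hv pi0 vpi.
Let cbt : connected bt := bt_connected hv pi0 vpi.

Let spans W := [/\ W `<=` verts bt, is_tree (induced bt W) &
  forall u w, S u -> S w -> u <> w -> apartment v u w `<=` W].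

Lemma spanned_spans x W : X x -> spans W -> W x.
Proof. by move=> Xx [WV tW aW]; exact: Xx. Qed.

Lemma spanned_verts : X `<=` verts bt.
Proof.
move=> x Xx; apply: (spanned_spans Xx); split=> //.
  rewrite induced_full //; split=> //.
  by exists (vertex_of 1%:M); apply: bt_vertex_of; exact: unitmx1.
by move=> u w _ _ _ _ [P [uP _ _ ->]]; exact: bt_vertex_of.
Qed.

Lemma star_serre : serre_graph star.
Proof. exact: serre_induced. Qed.

Lemma star_acyclic : acyclic star.
Proof. exact: acyclic_induced. Qed.

Lemma star_connected : connected star.
Proof.
have -> : X = [set x | forall W, spans W -> W x].
  by apply/seteqP; split=> x h W; [case=> *; exact: h|move=> *; exact: h].
by apply: bigcap_connected => // W [_ [_ cW _] _].
Qed.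

Lemma apartment_star u w x : S u -> S w -> u <> w -> apartment v u w x -> verts star x.
Proof.
move=> Su Sw uw a; split; last by move=> W _ _ aW; exact: (aW u w).
by case: a => P [uP _ _ ->]; exact: bt_vertex_of.
Qed.

Lemma apartment_vertex_of P : P \in unitmx ->
  apartment v (line (col 0 P)) (line (col 1 P)) (vertex_of P).
Proof. by move=> uP; exists P. Qed.

Lemma apartment_diag P a d : P \in unitmx -> a != 0 -> d != 0 ->
  apartment v (line (col 0 P)) (line (col 1 P)) (vertex_of (P *m mat2 a 0 0 d)).
Proof.
move=> uP a0 d0; exists (P *m mat2 a 0 0 d); split=> //; first exact: diag_unit.
  rewrite [in RHS]colE -mulmxA -colE (col_mat2 _ _ _ _).1.
  rewrite (_ : col2 a 0 = a *: delta_mx 0 0); last first.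
    by apply/matrixP; elim/ord2P => j; rewrite ord1 !mxE /= ?mulr1 ?mulr0.
  by rewrite -scalemxAr line_scale // -colE.
rewrite [in RHS]colE -mulmxA -colE (col_mat2 _ _ _ _).2.
rewrite (_ : col2 0 d = d *: delta_mx 1 0); last first.
  by apply/matrixP; elim/ord2P => j; rewrite ord1 !mxE /= ?mulr1 ?mulr0.
by rewrite -scalemxAr line_scale // -colE.
Qed.

Lemma diag_edges P : P \in unitmx ->
  edges bt (vertex_of P, vertex_of (P *m mat2 1 0 0 pi)) /\
  edges bt (vertex_of P, vertex_of (P *m mat2 pi 0 0 1)).
Proof.
move=> uP; have n1 : (1 : k) != 0 := oner_neq0 k.
have b1 := bt_vertex_of v (diag_unit uP n1 pi0); have b2 := bt_vertex_of v (diag_unit uP pi0 n1).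
split; split=> //=; try exact: bt_vertex_of; first exact: adjacent_step.
have [gs us] : GLO v (mat2 0 1 1 0) /\ P *m mat2 0 1 1 0 \in unitmx.
  by split; [exact: swap_GLO|rewrite unitmx_mul uP; case: (swap_GLO hv)].
apply/(adjacentP hv pi0 vpi) => //; first exact: bt_vertex_of.
exists (P *m mat2 0 1 1 0); split=> //.
  by rewrite (vertex_of_mulGLO hv uP (GLO_homothetic gs)).
rewrite -[RHS](vertex_of_mulGLO hv _ (GLO_homothetic gs)); last first.
  by rewrite unitmx_mul us step_unit.
by rewrite /stepmx -!mulmxA !mul_mat2 !(mulr0, mul0r, mulr1, mul1r, addr0, add0r).
Qed.

Lemma diag_neq P : P \in unitmx -> vertex_of (P *m mat2 1 0 0 pi) <> vertex_of (P *m mat2 pi 0 0 1).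
Proof.
move=> uP /(vertex_of_diag hv uP); rewrite oner_neq0 pi0 valuation1 // vpi => /(_ isT isT isT isT).
by clear; lia.
Qed.

Lemma singleton_tree x : verts bt x -> is_tree (induced bt [set x]).
Proof.
move=> vx; split; first by exists x.
- by move=> y z [vy ->] [vz ->]; exists [::].
- exact: acyclic_induced.
Qed.

(** If there were not two distinct points, every single vertex would be a subtree to
    intersect. *)
Lemma two_points x : verts star x -> exists u w, [/\ S u, S w & u <> w].
Proof.
move=> [vx Xx]; apply: contrapT => h; have /bt_vertP[P uP ex] := vx.
have [[_ vy _] _] := diag_edges uP.
have sub W : W `<=` verts bt -> is_tree (induced bt W) -> W x.
  by move=> WV tW; apply: Xx => // u w Su Sw uw; case: h; exists u, w.
have : [set vertex_of (P *m mat2 1 0 0 pi)] x.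
  by apply: sub; [move=> _ ->|exact: singleton_tree].
rewrite /= ex => /esym; rewrite -{2}[P]mulmx1 mat2_1 => /(vertex_of_diag hv uP).
rewrite oner_neq0 pi0 valuation1 // vpi => /(_ isT isT isT isT).
by clear; lia.
Qed.

Lemma apartment_nonempty u w : S u -> S w -> u <> w -> apartment v u w !=set0.
Proof.
move=> /SP1[a a0 <-] /SP1[b b0 <-] ab.
pose P := mat2 (a 0 0) (b 0 0) (a 1 0) (b 1 0).
have eP : col 0 P = a /\ col 1 P = b.
  by rewrite /P; split; [rewrite (col_mat2 _ _ _ _).1|rewrite (col_mat2 _ _ _ _).2];
    rewrite -col2_eta.
have uP : P \in unitmx.
  rewrite unitmx_det det_mat2; apply/negP => /eqP d0; apply: ab.
  have prop (s t : k) : s != 0 -> b = (t / s) *: a -> line a = line b.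
    move=> s0 e; rewrite e line_scale //; apply: contra b0 => /eqP z.
    by rewrite e z scale0r.
  move/eqP: d0; rewrite subr_eq0 => /eqP d0.
  have [z0|n0] := eqVneq (a 0 0) 0; last first.
    apply: (prop (a 0 0) (b 0 0)) => //; apply/matrixP; elim/ord2P => j;
      rewrite ord1 !mxE ?divfK //.
    by apply: (mulfI n0); rewrite d0 mulrA [a 0 0 * _]mulrC divfK.
  have [z1|n1] := eqVneq (a 1 0) 0.
    case/negP: a0; apply/eqP/matrixP; elim/ord2P => j; rewrite ord1 [RHS]mxE //.
  apply: (prop (a 1 0) (b 1 0)) => //; apply/matrixP; elim/ord2P => j;
    rewrite ord1 !mxE ?divfK //.
  by apply: (mulfI n1); rewrite mulrC -d0 z0 !mul0r !mulr0.
by exists (vertex_of P); rewrite -eP.1 -eP.2; exact: apartment_vertex_of.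
Qed.

(** A vertex with at most one neighbour lies on no apartment and could be removed from
    the spanned subtree. *)
Lemma star_valency y z : verts star y ->
  exists z', z' <> z /\ edges star (y, z').
Proof.
move=> sy; apply: contrapT => h.
have only z' : edges star (y, z') -> z' = z.
  by move=> e; apply: contrapT => n; apply: h; exists z'.
have [vy Xy] := sy; have [u0 [w0 [Su0 Sw0 uw0]]] := two_points sy.
have apW u w : S u -> S w -> u <> w ->
    apartment v u w `<=` verts star `&` [set x | x <> y].
  move=> Su Sw uw x ax; split; first exact: apartment_star ax.
  move=> xy; rewrite xy in ax; have [P [uP eu ew ey]] := ax.
  have n1 : (1 : k) != 0 := oner_neq0 k.
  have [e1 e2] := diag_edges uP.
  have a1 : verts star (vertex_of (P *m mat2 1 0 0 pi)).
    by apply: (apartment_star Su Sw uw); rewrite eu ew; exact: apartment_diag.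
  have a2 : verts star (vertex_of (P *m mat2 pi 0 0 1)).
    by apply: (apartment_star Su Sw uw); rewrite eu ew; exact: apartment_diag.
  apply: (diag_neq uP); transitivity z; first apply: only.
    by rewrite ey; split=> //; [rewrite /= -ey|case: a1].
  symmetry; apply: only.
  by rewrite ey; split=> //; [rewrite /= -ey|case: a2].
have : (X `&` [set x | x <> y]) y; last by case.
apply: (spanned_spans Xy); split.
- by move=> x [Xx _]; exact: spanned_verts.
- rewrite -induced_cap; split.
  + have [x ax] := apartment_nonempty Su0 Sw0 uw0.
    by have [sx nx] := apW _ _ Su0 Sw0 uw0 _ ax; exists x.
  + apply: remove_end_vertex; [exact: star_serre|exact: star_connected|].
    move=> [a b] [a' b'] /= e e' ea ea'; rewrite ea ea' in e e' *.
    by rewrite (only b e) (only b' e').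
  + by do 2!apply: acyclic_induced.
- move=> u w Su Sw uw x /(apW u w Su Sw uw) [[_ Xx] nx]; by split.
Qed.


(** The half-line from the vertex to the end is fixed.  It lies in the spanned subtree:
    far enough it follows an apartment, and subtrees are convex. *)
Lemma fixed_edge n y w e : verts star y -> act_vertex n y = y ->
  w != 0 -> S (line w) -> matrix_of n *m w = e *: w ->
  exists z, edges star (y, z) /\ act_vertex n z = z.
Proof.
move=> sy ny w0 Sw nw; have [vy Xy] := sy; have /bt_vertP[P uP ey] := vy.
have [l [Sl lw]] : exists l, S l /\ l <> line w.
  have [l [l' [Sl Sl' ll']]] := two_points sy.
  have [e1|n1] := pselect (l = line w); last by exists l.
  by exists l'; split=> //; rewrite -e1; apply: nesym.
have [w' w'0 el] := SP1 Sl; rewrite -el in lw Sl.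
have [Q [uQ eQ lQ]] := vertex_of_first_column hv uP w0.
rewrite -lQ in lw Sw.
have [i ai] := ray_apartment hv pi0 vpi uQ w'0 lw.
have [_ Xi] := apartment_star Sw Sl (nesym lw) ai.
have y0 : y = ray v pi Q 0 by rewrite ray0 eQ.
have [p [szp wp rp np]] := ray_walk hv pi0 vpi i.+1 uQ.
have wp' : walk star (ray v pi Q 0) p (ray v pi Q i.+1).
  have [_ cX _] : is_tree star by split; [exists y|exact: star_connected|exact: star_acyclic].
  by apply: (subtree_convex sbt abt cX) => //; rewrite -y0.
exists (ray v pi Q 1); split.
  case: p szp wp' np {wp rp} => [//|f p] _ [Gf _ _] np.
  by have ef : f = (_, _) := np 0%N isT; rewrite y0 -ef.
rewrite ey -eQ in ny; have [U gU hU] := stabilizer_basis hv uQ ny.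
have [iU uU _] := gU.
have U10 : U 1 0 = 0.
  have [c c0 eU] := in_basis_matrix uQ hU.
  have [a a0 ew] := line_eq w0 lQ; pose E := col2 1 0 : 'cV[k]_2.
  have eE : col 0 Q = Q *m E.
    by rewrite colE; congr (_ *m _); apply/matrixP; elim/ord2P => j; rewrite ord1 !mxE.
  have : c *: (U *m E) = e *: E.
    apply: (can_inj (mulKmx uQ)); apply: (scalerI a0).
    rewrite -!scalemxAr mulmxA scalemxAl -eU -mulmxA -eE scalemxAr -ew nw.
    by rewrite ew scalerA mulrC -scalerA.
  rewrite /E (mat2_eta U) mul_mat2_col2 !scale_col2 => /matrixP/(_ 1 0).
  rewrite !mxE /= !mulr0 mulr1 addr0 => cU; by apply: (mulfI c0); rewrite cU mulr0.
have eD : ray v pi Q 1 = vertex_of (Q *m stepmx pi) by rewrite /ray expr1.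
rewrite eD (act_vertex_of_basis hv uQ (step_unit pi0) hU).
have -> : U *m stepmx pi = stepmx pi *m mat2 (U 0 0) (U 0 1 * pi) 0 (U 1 1).
  rewrite {1}(mat2_eta U) U10 !mul_mat2 !(mulr0, mul0r, mulr1, mul1r, addr0, add0r).
  by rewrite (mulrC pi).
rewrite mulmxA vertex_of_mulGLO // ?unitmx_mul ?uQ ?step_unit //.
have dU : \det U = U 0 0 * U 1 1 by rewrite {1}(mat2_eta U) det_mat2 U10 mulr0 subr0.
have vU := GLO_det hv gU; rewrite unitmx_det in uU; rewrite dU in vU uU.
apply/GLO_homothetic/GLO_mat2; rewrite ?val_ge0 ?mulr0 ?subr0 //; try exact: iU.
by rewrite -[X in val_ge _ X]addr0; apply: (val_geM hv); [exact: iU|rewrite val_geE // vpi].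
Qed.

End SpannedSubtree.

(** * The action of the normalizer *)

Section Action.
Variables (k : fieldType) (v : k -> int).
Hypothesis hv : discrete_valuation v.
Variable pi : k.
Hypotheses (pi0 : pi != 0) (vpi : v pi = 1).
Local Notation vertex_of := (vertex_of v).
Local Notation bt := (bt_tree v).
Implicit Types (x y : PGL2 k) (P : 'M[k]_2) (l : set 'cV[k]_2) (z : vertex k).

Lemma act_set1 l : P1 l -> act_set 1%g l = l.
Proof.
case=> u _ <-; have u1 := unitmx1 k 2.
by have := act_line_basis u u1 (in_basis1 u1); rewrite !mul1mx.
Qed.

Lemma act_setM x y l : P1 l -> act_set (x * y)%g l = act_set x (act_set y l).
Proof.
case=> u _ <-; have [c c0 e] := matrix_ofM x y.
by rewrite !act_line e -scalemxAl line_scale // mulmxA.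
Qed.

Lemma act_vertex1 z : verts bt z -> act_vertex 1%g z = z.
Proof.
case/bt_vertP => P uP ->; have := act_vertex_of_basis hv uP (unitmx1 k 2) (in_basis1 uP).
by rewrite !mulmx1.
Qed.

Lemma act_vertexM x y z : verts bt z ->
  act_vertex (x * y)%g z = act_vertex x (act_vertex y z).
Proof.
case/bt_vertP => P uP ->; have [c c0 e] := matrix_ofM x y.
rewrite !act_vertex_of e -scalemxAl vertex_of_scale ?mulmxA //.
by rewrite !unitmx_mul !matrix_of_unit.
Qed.

Lemma act_bt_verts x z : verts bt z -> verts bt (act_vertex x z).
Proof.
case/bt_vertP => P uP ->; rewrite act_vertex_of; apply: bt_vertex_of.
by rewrite unitmx_mul matrix_of_unit.
Qed.

Lemma act_bt_edges x e : edges bt e -> edges bt (act_edge x e).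
Proof.
move=> [vs vt /(adjacentP hv pi0 vpi vs vt)[P [uP e1 e2]]].
split; [exact: act_bt_verts|exact: act_bt_verts|].
apply/(adjacentP hv pi0 vpi); [exact: act_bt_verts|exact: act_bt_verts|].
exists (matrix_of x *m P); split.
- by rewrite unitmx_mul matrix_of_unit.
- by rewrite /= e1 act_vertex_of.
- by rewrite /= e2 act_vertex_of mulmxA.
Qed.

Lemma act_apartment x u w z : apartment v u w z ->
  apartment v (act_set x u) (act_set x w) (act_vertex x z).
Proof.
case=> P [uP -> -> ->]; exists (matrix_of x *m P); split.
- by rewrite unitmx_mul matrix_of_unit.
- by rewrite act_line !colE mulmxA.
- by rewrite act_line !colE mulmxA.
- by rewrite act_vertex_of.
Qed.

Variable N : set (PGL2 k).
Hypotheses (N1 : N 1%g) (NM : forall x y, N x -> N y -> N (x * y)%g)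
  (NV : forall x, N x -> N x^-1%g).
Let S := limit_points v N `|` torsion_fixed_points N.

Lemma special_P1 l : S l -> P1 l.
Proof.
case=> [[b [a [_ _ _ [u [w [_ [w0 ->] _]]]]]]|[] //].
by exists w.
Qed.

Lemma act_special n l : N n -> S l -> S (act_set n l).
Proof.
move=> Nn Sl; have Pl := special_P1 Sl.
case: Sl => [[b [a [Pb inj Na [u [w [ul [w0 lw] cv]]]]]]|[_ [x [Nx x1 [m m0 xm] xl]]]].
  left; exists b, (fun i => n * a i)%g; split=> //.
  - by move=> i j /mulgI/inj.
  - by move=> i; exact: NM.
  exists (fun i => matrix_of n *m u i), (matrix_of n *m w); split.
  - move=> i; have [u0 e] := ul i; split.
      by apply: mulmx_neq0 => //; exact: matrix_of_unit.
    by rewrite act_setM // e act_line.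
  - split; last by rewrite lw act_line.
    by apply: mulmx_neq0 => //; exact: matrix_of_unit.
  - exact: converges_mulmx.
right; split; first exact: act_P1.
exists (n * x * n^-1)%g; split.
- by apply: NM; [exact: NM|exact: NV].
- move=> e; apply: x1; apply: (mulgI n); apply: (mulIg n^-1%g).
  by rewrite e mulg1 mulgV.
- exists m => //; have conjX i : ((n * x * n^-1) ^+ i = n * x ^+ i * n^-1)%g.
    elim: i => [|i IH]; first by rewrite !expg0 mulg1 mulgV.
    by rewrite expgS IH [(x ^+ i.+1)%g]expgS !mulgA mulgVK.
  by rewrite conjX xm mulg1 mulgV.
- rewrite act_setM; last exact: act_P1.
  by rewrite -(act_setM n^-1%g) // mulVg act_set1 // act_setM // xl.
Qed.

Lemma act_specialK n l : P1 l -> act_set n^-1%g (act_set n l) = l.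
Proof. by move=> Pl; rewrite -act_setM // mulVg act_set1. Qed.

Lemma act_vertexK n z : verts bt z -> act_vertex n^-1%g (act_vertex n z) = z.
Proof. by move=> vz; rewrite -act_vertexM // mulVg act_vertex1. Qed.

Lemma act_vertexVK n z : verts bt z -> act_vertex n (act_vertex n^-1%g z) = z.
Proof. by move=> vz; rewrite -act_vertexM // mulgV act_vertex1. Qed.

(** The translates of the subtrees containing all the apartments are such
    subtrees again. *)
Lemma act_spanned n z : N n -> spanned_subtree v S z ->
  spanned_subtree v S (act_vertex n z).
Proof.
move=> Nn Xz W WV [[y [vy Wy]] cW _] aW.
suff [] : [set z | verts bt z /\ W (act_vertex n z)] z by [].
apply: Xz => [t []//||u w Su Sw uw t at_].
- split.
  + exists (act_vertex n^-1%g y); have vy' := act_bt_verts n^-1%g vy.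
    by split=> //; split=> //; rewrite act_vertexVK.
  + move=> a b [va [_ Wa]] [vb [_ Wb]].
    have [p wp] := cW _ _ (conj (act_bt_verts n va) Wa) (conj (act_bt_verts n vb) Wb).
    exists (map (act_edge n^-1%g) p).
    rewrite -(act_vertexK n va) -(act_vertexK n vb).
    apply: walk_map wp => [t [vt Wt]|[s t] [Ge Ws Wt]].
      have vt' := act_bt_verts n^-1%g vt.
      by split=> //; split=> //; rewrite act_vertexVK.
    have Ge' := act_bt_edges n^-1%g Ge; have [vs vt _] := Ge.
    split=> //; split=> //; split; rewrite ?act_vertexVK //; exact: act_bt_verts.
  + exact/acyclic_induced/(bt_acyclic hv pi0 vpi).
- split; first by case: at_ => P [uP _ _ ->]; exact: bt_vertex_of.
  apply: (aW (act_set n u) (act_set n w)); [exact: act_special|exact: act_special| |].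
    move=> e; apply: uw.
    by rewrite -(act_specialK n (special_P1 Su)) e act_specialK //; exact: special_P1.
  exact: act_apartment.
Qed.

Lemma tree_star_action : graph_action (@act_vertex k) (@act_edge k) (tree_star v N) N.
Proof.
split=> //.
- by move=> n x Nn [vx Xx]; split; [exact: act_bt_verts|exact: act_spanned].
- move=> n [s t] Nn [Ge Xs Xt]; split; first exact: act_bt_edges.
    exact: (act_spanned Nn Xs).
  exact: (act_spanned Nn Xt).
- by move=> x [vx _]; exact: act_vertex1.
- by move=> [s t] [[vs vt _] _ _]; rewrite /act_edge /= !act_vertex1.
- by move=> m n x Nm Nn [vx _]; exact: act_vertexM.
- by move=> m n [s t] Nm Nn [[vs vt _] _ _]; rewrite /act_edge /= !act_vertexM.
Qed.

End Action.

(** * Sections have no end vertices *)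

Section Leafless.
Variables (k : fieldType) (v : k -> int).
Hypothesis hv : discrete_valuation v.
Variables (r : nat) (Gamma : set (PGL2 k)).
Hypotheses (hr : (2 <= r)%N) (schottky_Gamma : schottky v r Gamma).
Let N := normalizer Gamma.
Hypothesis rational : torsion_fixed_points_rational N.
Local Notation star := (tree_star v N).

(** Every edge of the tree at an end vertex of the section is a translate of the only
    edge of the section there, so the stabilizer permutes these edges transitively.
    There are at least two of them.  The stabilizer is finite, and each of its elements
    fixes one of these edges, the first one towards its own fixed point.  This
    contradicts Jordan's theorem. *)
Lemma section_leafless D :
  is_section (@act_vertex k) (@act_edge k) star N D ->
  forall e, edges (induced star D) e ->
    exists2 f, edges (induced star D) f /\ src star f = tgt star e & f <> rev star e.
Proof.
move=> hD; have [pi pi0 vpi] := valuation_uniformizer hv.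
have [free disc] := schottky_Gamma.
have [G1 GM GV] := free_subgroup free.
have [a [b [Ga Gb nab]]] := free_noncommuting_squares free hr.
have N1 := normalizer1 Gamma.
have NM := @normalizerM _ Gamma; have NV := @normalizerV _ Gamma.
have aN := tree_star_action hv pi0 vpi N1 NM NV.
have SP1 := @special_P1 k v N.
have sstar : serre_graph star := @star_serre _ _ hv _ pi0 vpi _.
move=> [z0 y] De; apply: contrapT => nof.
have [Ge Dz0 Dy] := De; have [_ Gr _ _] := sstar _ Ge.
have [sy _] := serre_tgt sstar Ge; have [vy _] := sy.
have only f : edges (induced star D) f -> f.1 = y -> f = (y, z0).
  by move=> Df fy; apply: contrapT => nf; apply: nof; exists f.
pose H := [set n | N n /\ act_vertex n y = y].
have finH : finite_set H := finite_stabilizer hv GM GV disc Ga Gb nab vy.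
have H1 : H 1%g := conj N1 (act_vertex1 hv vy).
have HM m n : H m -> H n -> H (m * n)%g.
  by move=> [Nm my] [Nn ny]; split; [exact: NM|rewrite (act_vertexM hv) // ny].
have all_z0 : forall z, edges star (y, z) -> z = z0.
  apply: (transitive_fixed_points HM finH (act := @act_vertex k)) => //.
  - by move=> h z [Nh hy] Gz; have := ga_edges aN Nh Gz; rewrite /act_edge /= hy.
  - by move=> m n z _ _ [[_ vz _] _ _]; exact: (act_vertexM hv).
  - by move=> z [[_ vz _] _ _]; exact: (act_vertex1 hv).
  - move=> z /(section_edge aN hD)[[c d] [n [Df Nn [yn zn]]]].
    have Dc : D c by case: Df.
    have nc : act_vertex n c = c by apply: (section_vertex_uniq aN hD) => //; rewrite -yn.
    have [ec ed] := only _ Df (etrans (esym nc) (esym yn)).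
    by exists n; [split=> //; rewrite -{1}ec -yn|rewrite -ed].
  - move=> h Hh; have [Nh hy] := Hh; have [->|h1] := pselect (h = 1%g).
      by exists z0 => //; apply: (act_vertex1 hv); have [[]] := Gr.
    have fh := finite_group_order H1 HM finH Hh.
    have [w [c [w0 hw]]] := torsion_eigenvector rational Nh h1 fh.
    have c0 : c != 0.
      apply/negP => /eqP c0; have := mulmx_neq0 (matrix_of_unit h) w0.
      by rewrite hw c0 scale0r eqxx.
    have Sw : torsion_fixed_points N (line w).
      split; first by exists w.
      by exists h; split=> //; rewrite act_line hw line_scale.
    by have [z [Gz hz]] := fixed_edge hv pi0 vpi SP1 sy hy w0 (or_intror Sw) hw; exists z.
have [z [nz /all_z0]] := star_valency hv pi0 vpi SP1 z0 sy; exact: nz.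
Qed.

End Leafless.

Unset Implicit Arguments.

Theorem proposition1 (k : fieldType) (p : nat) (hp : p \in [pchar k])
  (v : k -> int) (hv : discrete_valuation v) (hcomplete : complete_for v)
  (g : nat) (hg : (2 <= g)%N)
  (Gamma N : set (PGL2 k)) (hGamma : schottky v g Gamma)
  (hN : N = normalizer Gamma)
  (hrational : torsion_fixed_points_rational N)
  (hinversion : without_inversion (@act_edge k) (bt_tree v) N)
  (hgenus0 : is_tree
     (quotient_graph (@act_vertex k) (@act_edge k) (tree_star v N) N))
  (D : set (vertex k))
  (hD : is_section (@act_vertex k) (@act_edge k) (tree_star v N) N D)
  (T : set (vertex k)) (hTD : T `<=` D)
  (hT : is_tree (induced (tree_star v N) T))
  (hends : same_ends (induced (tree_star v N) D) (induced (tree_star v N) T)) :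
  let TN :=
    stabilizer_tree (@act_vertex k) (@act_edge k) (tree_star v N) N D in
  contraction TN T /\ is_amalgam (sub_tree_of_groups TN T) N /\ is_amalgam TN N.
Proof.
move=> TN; have [pi pi0 vpi] := valuation_uniformizer hv.
have sstar : serre_graph (tree_star v N) := @star_serre _ _ hv _ pi0 vpi _.
have astar : acyclic (tree_star v N) := @star_acyclic _ _ hv _ pi0 vpi _.
have cstar : connected (tree_star v N) := @star_connected _ _ hv _ pi0 vpi _.
have [DG tD _ _] := hD; have [_ cD _] := tD.
have TeqD : T = D.
  apply/seteqP; split=> // x Dx.
  apply: (leafless_same_ends (G := induced (tree_star v N) D)).
  - exact: serre_induced.
  - exact: acyclic_induced.
  - exact: cD.
  - by rewrite hN in hrational hD *; exact: (section_leafless hv hg hGamma).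
  - by rewrite induced_induced.
  - by rewrite induced_induced.
  - by split=> //; exact: DG.
have aN : graph_action (@act_vertex k) (@act_edge k) (tree_star v N) N.
  apply: (tree_star_action hv pi0 vpi); rewrite hN; first exact: normalizer1.
  - exact: normalizerM.
  - exact: normalizerV.
have amalgam : is_amalgam TN N := section_amalgam sstar aN hD astar cstar.
rewrite TeqD; have DD : induced (induced (tree_star v N) D) D = induced (tree_star v N) D.
  exact: induced_induced.
split; last by split=> //; rewrite /sub_tree_of_groups /= DD.
split; [by move=> x Dx; split=> //; exact: DG|by rewrite /= DD|].
by move=> x y q [_ Dx].
Qed.
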